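(* Let $p, m \in \mathbb{N}$ (positive integers) with $p$ even and $m$ odd. Put $$s = mp-2,\qquad r = p(m-1),\qquad \lambda = \frac{s}{2},\qquad \nu = \frac{p}{2}.$$ Let $$A(x) = \sum_{k=0}^{p} a_k x^{p-k} \quad\text{and}\quad B(x) = \sum_{k=0}^{p-2} b_k x^{p-2-k}$$ be polynomials with real coefficients, where $a_0\neq 0$ and $A$ has no real zeros. Let $e_0,\dots,e_p$ and $z_0,\dots,z_r$ be the coefficients associated with $A$ and $m$ as defined in the context, and let $$c_j = \sum_{k=0}^{j} z_k b_{j-k}\qquad (0\le j\le s),$$ with the conventions $b_i=0$ if $i>p-2$ and $z_i=0$ if $i>r$. Define $$H(x) = \sum_{l=0}^{p} e_l x^{p-l}$$ and \begin{align*} J(x) = {}& \frac{1}{2^{s}} \sum_{\gamma=0}^{\nu-1}\left(\binom{\nu-1}{\gamma}\sum_{j=0}^{\lambda} (-1)^{j} c_{2j}\, T_{\lambda}(2j,s-2j)\right) x^{2\gamma}\\ &+ \frac{1}{2^{s}} \sum_{\gamma=0}^{\nu-2}\left(\sum_{j=0}^{\lambda}\sum_{\alpha=1}^{\nu-1-\gamma}\sum_{\beta=0}^{\alpha} M_1(j,\alpha,\beta,\gamma)\right) x^{2\gamma}\\ &+ \frac{1}{2^{s}} \sum_{\gamma=1}^{\nu-1}\left(\sum_{j=0}^{\lambda}\sum_{\alpha=\nu-\gamma}^{\nu-1}\ \sum_{\beta=\alpha-\nu+\gamma+1}^{\alpha} M_1(j,\alpha,\beta,\gamma)\right) x^{2\gamma}\\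 &+ \frac{1}{2^{s}} \sum_{\gamma=0}^{\nu-2}\left(\sum_{j=0}^{\lambda-1}\sum_{\alpha=1}^{\nu-1-\gamma}\sum_{\beta=0}^{\alpha-1} M_2(j,\alpha,\beta,\gamma)\right) x^{2\gamma+1}\\ &+ \frac{1}{2^{s}} \sum_{\gamma=1}^{\nu-2}\left(\sum_{j=0}^{\lambda-1}\sum_{\alpha=\nu-\gamma}^{\nu-1}\sum_{\beta=0}^{\alpha-1} M_2(j,\alpha,\beta,\gamma)\right) x^{2\gamma+1}, \end{align*} where $$M_1(j,\alpha,\beta,\gamma) = (-1)^{j+\alpha-\beta} c_{2j}\,\frac{2^{2(\alpha-\beta)}\,\alpha}{2\alpha-\beta}\binom{2\alpha-\beta}{\beta}\binom{\nu-\alpha-1+\beta}{\gamma}\left[T_{\lambda+\alpha m}(2j,s-2j)+T_{\lambda-\alpha m}(2j,s-2j)\right]$$ and $$M_2(j,\alpha,\beta,\gamma) = (-1)^{j+\beta} c_{2j+1}\,2^{2\beta+1}\binom{\alpha+\beta}{2\beta+1}\binom{\nu-2-\beta}{\gamma}\left[T_{\lambda+\alpha m}(2j+1,s-2j-1)-T_{\lambda-\alpha m}(2j+1,s-2j-1)\right].$$ Then $$\int_{-\infty}^{\infty}\frac{B(x)}{A(x)}\,dx = \int_{-\infty}^{\infty}\frac{J(x)}{H(x)}\,dx .$$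
   Context: For integers $x,a,b\ge 0$, $$T_x(a,b) = \sum_{j=0}^{x} (-1)^{a-x+j}\binom{a}{x-j}\binom{b}{j},$$ where binomial coefficients $\binom{n}{k}$ with $n\ge 0$ and $k>n$ are $0$. Empty sums are $0$. For $m\in\mathbb{N}$, $m\geq 1$, define $$P_m(x) = \sum_{j=0}^{\lfloor m/2\rfloor}(-1)^j\binom{m}{2j}x^{m-2j},\qquad Q_m(x)=\sum_{j=0}^{\lfloor (m-1)/2\rfloor}(-1)^j\binom{m}{2j+1}x^{m-(2j+1)},\qquad R_m(x) = \frac{P_m(x)}{Q_m(x)}.$$ All zeros of $Q_m$ are real. The elementary symmetric functions $\sigma_l^{(p)}$ are defined by $\prod_{l=1}^p (y-y_l) = \sum_{l=0}^p (-1)^l\sigma_l^{(p)}(y_1,\dots,y_p)\,y^{p-l}$. Coefficients associated with $A$ and $m$: let $x_1,\dots,x_p\in\mathbb{C}$ be the roots of $A$ listed with multiplicity (none is real, so $Q_m(x_j)\ne0$). For $0\le l\le p$ set $$e_l = a_0^m(-1)^l\prod_{j=1}^p Q_m(x_j)\cdot \sigma_l^{(p)}\big(R_m(x_1),\dots,R_m(x_p)\big),$$ and let $$E(x) = \sum_{l=0}^p e_l\,[P_m(x)]^{p-l}[Q_m(x)]^l .$$ Then $A$ divides $E$, and $z_0,\dots,z_r$ (with $r=p(m-1)$) are the coefficients of the polynomial $Z(x)=\sum_{k=0}^r z_k x^{r-k}$ determined by $A(x)Z(x)=E(x)$. *)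

(* Defs.v *)
From mathcomp Require Import all_boot all_order all_algebra.
From mathcomp Require Import complex.
From mathcomp Require Import all_classical all_reals all_analysis.

Set Implicit Arguments.
Unset Strict Implicit.
Unset Printing Implicit Defensive.

Import Order.TTheory GRing.Theory Num.Theory.
Local Open Scope ring_scope.

(* The exponent a - x + j is a genuine (possibly negative) integer. *)
Definition Tsum (x a b : nat) : int :=
  \sum_(0 <= j < x.+1)
    (-1) ^ (a%:Z - x%:Z + j%:Z) * 'C(a, x - j)%:Z * 'C(b, j)%:Z.

(* The paper writes polynomials as sum_k q_k x^(d-k); [dcoef d q k] is q_k,
   extended by 0 for k > d. *)
Definition dcoef (F : nzRingType) (d : nat) (q : {poly F}) (k : nat) : F :=
  if (k <= d)%N then q`_(d - k) else 0.

Section Landen.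
Variable F : fieldType.
Implicit Types (xs ys : seq F) (m p l : nat) (A : {poly F}) (c : nat -> F).

Definition Ppoly m : {poly F} :=
  \sum_(0 <= j < (m %/ 2).+1)
    ((-1) ^+ j * ('C(m, 2 * j))%:R) *: 'X^(m - 2 * j).

Definition Qpoly m : {poly F} :=
  \sum_(0 <= j < ((m - 1) %/ 2).+1)
    ((-1) ^+ j * ('C(m, 2 * j + 1))%:R) *: 'X^(m - (2 * j + 1)).

Definition Rfrac m (x : F) : F := (Ppoly m).[x] / (Qpoly m).[x].

(* From prod_i (X - y_i) = sum_l (-1)^l sigma_l X^(p-l), with p = size ys. *)
Definition esym ys l : F :=
  (-1) ^+ l * dcoef (size ys) (\prod_(y <- ys) ('X - y%:P)) l.

Definition ecoef (a0 : F) m xs l : F :=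
  a0 ^+ m * (-1) ^+ l * (\prod_(x <- xs) (Qpoly m).[x])
    * esym [seq Rfrac m x | x <- xs] l.

Definition Epoly (a0 : F) m p xs : {poly F} :=
  \sum_(0 <= l < p.+1) ecoef a0 m xs l *: (Ppoly m ^+ (p - l) * Qpoly m ^+ l).

Definition Hpoly (a0 : F) m p xs : {poly F} :=
  \sum_(0 <= l < p.+1) ecoef a0 m xs l *: 'X^(p - l).

(* When xs lists the roots of A, the division is exact, so that
   A * Zpoly A m p xs = Epoly (lead_coef A) m p xs. *)
Definition Zpoly A m p xs : {poly F} := Epoly (lead_coef A) m p xs %/ A.

Definition ccoef (z b : nat -> F) (j : nat) : F :=
  \sum_(0 <= k < j.+1) z k * b (j - k)%N.

Definition M1 m p c (j al be ga : nat) : F :=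
  let s := (m * p - 2)%N in
  let la := (s %/ 2)%N in
  let nu := (p %/ 2)%N in
  (-1) ^+ (j + (al - be)) * c (2 * j)%N
  * (2 ^+ (2 * (al - be)) * al%:R / (2 * al - be)%N%:R)
  * ('C(2 * al - be, be))%:R * ('C(nu - al - 1 + be, ga))%:R
  * (Tsum (la + al * m) (2 * j) (s - 2 * j)
     + Tsum (la - al * m) (2 * j) (s - 2 * j))%:~R.

Definition M2 m p c (j al be ga : nat) : F :=
  let s := (m * p - 2)%N in
  let la := (s %/ 2)%N in
  let nu := (p %/ 2)%N in
  (-1) ^+ (j + be) * c (2 * j + 1)%N * 2 ^+ (2 * be + 1)
  * ('C(al + be, 2 * be + 1))%:R * ('C(nu - 2 - be, ga))%:R
  * (Tsum (la + al * m) (2 * j + 1) (s - 2 * j - 1)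
     - Tsum (la - al * m) (2 * j + 1) (s - 2 * j - 1))%:~R.

(* All sums are over half-open ranges: an inclusive upper bound u becomes
   < u.+1, written so that truncated subtraction never turns an empty range
   into a nonempty one; e.g. 0..nu-2 is [0 <= ga < nu - 1], and 1..nu-1-ga is
   [1 <= al < nu - ga]. *)
Definition Jpoly m p c : {poly F} :=
  let s := (m * p - 2)%N in
  let la := (s %/ 2)%N in
  let nu := (p %/ 2)%N in
  (2 ^+ s)^-1 *: (\sum_(0 <= ga < nu)
     (('C(nu - 1, ga))%:R
        * \sum_(0 <= j < la.+1)
            (-1) ^+ j * c (2 * j)%N * (Tsum la (2 * j) (s - 2 * j))%:~R)
     *: 'X^(2 * ga))
  + (2 ^+ s)^-1 *: (\sum_(0 <= ga < nu - 1)
     (\sum_(0 <= j < la.+1) \sum_(1 <= al < nu - ga)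
        \sum_(0 <= be < al.+1) M1 m p c j al be ga)
     *: 'X^(2 * ga))
  + (2 ^+ s)^-1 *: (\sum_(1 <= ga < nu)
     (\sum_(0 <= j < la.+1) \sum_(nu - ga <= al < nu)
        \sum_(al + ga + 1 - nu <= be < al.+1) M1 m p c j al be ga)
     *: 'X^(2 * ga))
  + (2 ^+ s)^-1 *: (\sum_(0 <= ga < nu - 1)
     (\sum_(0 <= j < la) \sum_(1 <= al < nu - ga)
        \sum_(0 <= be < al) M2 m p c j al be ga)
     *: 'X^(2 * ga + 1))
  + (2 ^+ s)^-1 *: (\sum_(1 <= ga < nu - 1)
     (\sum_(0 <= j < la) \sum_(nu - ga <= al < nu)
        \sum_(0 <= be < al) M2 m p c j al be ga)
     *: 'X^(2 * ga + 1)).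

End Landen.

Section ComplexIntegral.
Variable R : realType.
Local Open Scope complex_scope.

(* Absolute integrability and integral over the whole real line, with respect
   to Lebesgue measure, of a real and of a complex-valued function. *)
Definition integrable_line (f : R -> R) : Prop :=
  (@lebesgue_measure R).-integrable setT (EFin \o f).

Definition integral_line (f : R -> R) : R :=
  \int[@lebesgue_measure R]_(x in setT) f x.

Definition cintegrable_line (f : R -> R[i]) : Prop :=
  integrable_line (fun x => complex.Re (f x)) /\
  integrable_line (fun x => complex.Im (f x)).

Definition cintegral_line (f : R -> R[i]) : R[i] :=
  integral_line (fun x => complex.Re (f x))
  +i* integral_line (fun x => complex.Im (f x)).

End ComplexIntegral.

(* Main.v *)
Require Import Defs.
From mathcomp Require Import all_boot all_order all_algebra.
From mathcomp Require Import complex.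
From mathcomp Require Import all_classical all_reals all_analysis.
From mathcomp Require Import measurable_realfun.
From mathcomp Require Import ring lra zify.

Import Order.TTheory GRing.Theory Num.Theory.
Import numFieldNormedType.Exports.
Local Open Scope ring_scope.

(** Put x = cot t. For real x, P_m(x) and Q_m(x) are the real and imaginary parts
    of (x + i)^m, so sin^m t times P_m(cot t), Q_m(cot t) is cos mt, sin mt, and
    the map x -> R_m(x) is multiplication of the angle by m. The number
    E(x) sin^(mp) t is therefore h(mt), where
      h(t) = a_0^m prod_j (Q_m(x_j) cos t - P_m(x_j) sin t) = H(cot t) sin^p t,
    and h has no real zero because no x_j is real.

    Since B/A = BZ/E and BZ has coefficients c_j, the first integrand becomes,
    with s = mp - 2,
      B(x)/A(x) dx = - [sum_j c_j cos^(s-j) t sin^j t] / h(mt) dt.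
    The generating function of the numbers T_x(a,b) turns the bracket into
    2^(-s) sum_k t_k exp(i(2k - s)t), where
    t_k = sum_j (-i)^j c_j T_k(j, s-j) ([tcoef], [tcoef_generating]).
    Shifting the index by one and putting psi(t) = exp(-ipt)/h(t), which has
    period pi because p is even, the integrand is
      2^(-s) sum_(0 < k < mp) t_(k-1) exp(2ikt) psi(mt).

    Over a period of length pi, a term with m not dividing k integrates to 0:
    the shift t -> t + pi/m multiplies it by a root of unity other than 1. In a
    term with k = mn, the variable mt can be replaced by t. This is
    [period_integral_decimation], and it leaves the integral of
      2^(-s) sum_(0 < n < p) t_(mn-1) exp(2int) psi(t).
    Pairing n = p/2 + alpha with n = p/2 - alpha and using
    T_(s-x)(j, s-j) = (-1)^j T_x(j, s-j) gives cosines of 2 alpha t from the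
    even c_j and sines from the odd ones; their Chebyshev expansions in powers of
    sin^2 t = 1/(1 + x^2) produce exactly the double sums M_1 and M_2 of J
    ([Jpoly_trig]), so the result is the integral of J/H.

    The integrals are handled through antiderivatives. The value of an integral
    over a period is the increment over pi of a primitive ([period_integral]),
    so linearity, shift and dilation are statements about derivatives, and
    Lebesgue integration over the line enters only through
    [line_integral_cot]: if G is a primitive of a continuous g, then
    - G(pi/2 - atan x) is a primitive of g(pi/2 - atan x)/(1 + x^2) with finite
    limits at both ends. *)

(** * Two ways of splitting a sum *)

Section BigSplit.
Variable V : zmodType.
Implicit Types (G : nat -> V).

Lemma sum_even_odd G n :
  \sum_(0 <= i < n) G i =
  \sum_(0 <= k < uphalf n) G (2 * k)%N + \sum_(0 <= k < n./2) G (2 * k + 1)%N.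
Proof.
elim: n => [|n IH]; first by rewrite !big_nil addr0.
rewrite big_nat_recr //= IH; case: (boolP (odd n)) => no.
  have e : uphalf n = n./2.+1 by rewrite uphalf_half no.
  rewrite {2}e [X in _ = _ + X]big_nat_recr //= addrA; congr (_ + G _).
    by rewrite e.
  by have := odd_double_half n; rewrite no -mul2n; lia.
have e : uphalf n = n./2 by rewrite uphalf_half (negbTE no).
rewrite e [X in _ = X + _]big_nat_recr //= addrAC; congr (_ + G _ + _).
by have := odd_double_half n; rewrite (negbTE no) -mul2n; lia.
Qed.

(** For the exponents of exp(i(2j - p)t), this pairs each frequency
    with its opposite. *)
Lemma sum_centered G n :
  \sum_(0 <= j < 2 * n.+1) G j =
  G 0%N + G n.+1 + \sum_(1 <= a < n.+1) (G (n.+1 + a)%N + G (n.+1 - a)%N).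
Proof.
have up : \sum_(n.+2 <= j < 2 * n.+1) G j = \sum_(1 <= a < n.+1) G (n.+1 + a)%N.
  rewrite -[n.+2]add1n big_addn (_ : (2 * n.+1 - n.+1 = n.+1)%N); last by lia.
  by apply: eq_big_nat => a _; rewrite addnC.
have down : \sum_(1 <= j < n.+1) G j = \sum_(1 <= a < n.+1) G (n.+1 - a)%N.
  by rewrite big_nat_rev /=; apply: eq_big_nat => a _; congr G; lia.
rewrite (big_cat_nat _ (n := n.+1)) //=; last by lia.
rewrite big_ltn // [X in _ + X]big_ltn; last by lia.
rewrite up down big_split /= addrACA; congr (_ + _); exact: addrC.
Qed.

End BigSplit.

(** * The numbers T_x(a,b) and the coefficients c_j *)

Section Homogenization.
Variable S : comNzRingType.

(** The homogenized polynomial of degree [size ys], so that [v] may vanish: over a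
    general commutative ring one cannot simply evaluate at [u / v]. *)
Lemma homogenize_prod (ys : seq S) (u v : S) :
  \sum_(0 <= i < (size ys).+1)
     (\prod_(y <- ys) ('X - y%:P))`_i * (u ^+ i * v ^+ (size ys - i))
  = \prod_(y <- ys) (u - y * v).
Proof.
elim: ys => [|y ys IH]; first by rewrite !big_nil big_nat1 coefC /= !mul1r.
rewrite [RHS]big_cons -IH (big_cons _ _ y ys xpredT (fun z => ('X - z%:P)))
  [size (_ :: _)]/=; set q := \prod_(_ <- _) ('X - _); set n := size ys.
have qn : q`_n.+1 = 0 by rewrite nth_default // size_prod_XsubC.
have low : \sum_(0 <= i < n.+2) (q * 'X)`_i * (u ^+ i * v ^+ (n.+1 - i))
         = u * \sum_(0 <= i < n.+1) q`_i * (u ^+ i * v ^+ (n - i)).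
  rewrite big_nat_recl // coefMX /= mul0r add0r big_distrr /=.
  by apply: eq_big_nat => i _; rewrite coefMX /= subSS exprS; ring.
have high : \sum_(0 <= i < n.+2) (y%:P * q)`_i * (u ^+ i * v ^+ (n.+1 - i))
         = y * v * \sum_(0 <= i < n.+1) q`_i * (u ^+ i * v ^+ (n - i)).
  rewrite big_nat_recr //= coefCM qn mulr0 mul0r addr0 big_distrr /=.
  by apply: eq_big_nat => i ?; rewrite coefCM subSn // exprS; ring.
rewrite [RHS]mulrBl -low -high -sumrB; apply: eq_bigr => i _.
by rewrite -mulrBl -coefB mulrBl [_ * 'X]mulrC.
Qed.

Lemma coef_Xaddn (c : S) n i :
  (('X + c%:P) ^+ n)`_i = c ^+ (n - i) * 'C(n, i)%:R.
Proof.
rewrite addrC exprDn (_ : \sum_(_ < _) _ =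
    \poly_(k < n.+1) (c ^+ (n - k) * 'C(n, k)%:R)).
  by rewrite coef_poly ltnS; case: leqP => // ?; rewrite bin_small // mulr0.
rewrite poly_def; apply: eq_bigr => k _.
by rewrite -polyC_exp mul_polyC -scaler_nat scalerA mulrC.
Qed.

(** T_x(a,b) is the coefficient of X^x in (X - 1)^a (X + 1)^b. The negative
    exponents of -1 in [Tsum] only occur with a vanishing binomial coefficient. *)
Lemma coef_Tsum a b x :
  (\prod_(y <- nseq a 1 ++ nseq b (-1)) ('X - y%:P))`_x = (Tsum x a b)%:~R :> S.
Proof.
rewrite big_cat !big_nseq !iter_mulr_1 /= mulrC.
rewrite -[1%:P]opprK -!polyCN !opprK coefM /Tsum big_mkord rmorph_sum /=.
apply: eq_bigr => j _; rewrite !coef_Xaddn expr1n mul1r !rmorphM /=.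
rewrite -!pmulrn mulrC; congr (_ * _).
have [h|h] := leqP (x - j) a; last by rewrite bin_small // !mulr0.
congr (_ * _); have jx : (j <= x)%N by rewrite -ltnS.
have -> : a%:Z - x%:Z + j%:Z = (a - (x - j))%N%:Z by lia.
by rewrite -exprnP rmorphXn rmorphN1.
Qed.

(** With u = exp(it) and v = exp(-it) the right-hand side is
    (2i sin t)^a (2 cos t)^b, so this is the Fourier expansion of
    sin^a t cos^b t. *)
Lemma Tsum_generating a b (u v : S) :
  \sum_(0 <= x < (a + b).+1) (Tsum x a b)%:~R * (u ^+ x * v ^+ (a + b - x))
  = (u - v) ^+ a * (u + v) ^+ b.
Proof.
have -> : (u - v) ^+ a * (u + v) ^+ b
        = \prod_(y <- nseq a 1 ++ nseq b (-1)) (u - y * v).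
  by rewrite big_cat !big_nseq !iter_mulr_1 /= mul1r mulN1r opprK.
rewrite -homogenize_prod size_cat !size_nseq.
by apply: eq_bigr => x _; rewrite coef_Tsum.
Qed.

End Homogenization.

(** Exchanging X and Y in the homogeneous form (X - Y)^a (X + Y)^b multiplies it
    by (-1)^a. The symmetry makes the even c_j contribute cosines and the odd
    ones sines. *)
Lemma Tsum_sym a b x : (x <= a + b)%N ->
  Tsum (a + b - x) a b = (-1) ^+ a * Tsum x a b.
Proof.
move=> xab; set n := (a + b)%N in xab *.
have e1 : \poly_(i < n.+1) Tsum i a b = ('X - 1) ^+ a * ('X + 1) ^+ b.
  rewrite -Tsum_generating poly_def big_mkord; apply: eq_bigr => i _.
  by rewrite expr1n mulr1 -(rmorph_int polyC) /= mul_polyC intz.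
have e2 : \poly_(i < n.+1) Tsum (n - i) a b = (1 - 'X) ^+ a * (1 + 'X) ^+ b.
  rewrite -Tsum_generating poly_def -(big_mkord xpredT (fun i => Tsum (n - i) a
    b *: 'X^i)).
  rewrite big_nat_rev /=; apply: eq_big_nat => i /andP[_ ?].
  rewrite expr1n mul1r -(rmorph_int polyC) /= mul_polyC intz add0n subSS subKn
    //.
have e3 : (1 - 'X) ^+ a * (1 + 'X) ^+ b
        = (-1) ^+ a * (('X - 1) ^+ a * ('X + 1) ^+ b) :> {poly int}.
  by rewrite -opprB [in LHS]exprNn (addrC 1) mulrA.
move: e3; rewrite -e1 -e2 => /polyP /(_ x);
  rewrite -(signr_odd {poly int} a) -(signr_odd int a).
by case: (odd a); rewrite ?expr0 ?expr1 ?mul1r ?mulN1r ?coefN !coef_poly ltnS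
  xab.
Qed.

(** The terms cut off by [dcoef] on the left are those whose index exceeds the
    degree of a factor on the right. *)
Lemma coef_conv (S : fieldType) (r q j : nat) (Z B : {poly S}) :
  (size Z <= r.+1)%N -> (size B <= q.+1)%N -> (j <= r + q)%N ->
  ccoef (dcoef r Z) (dcoef q B) j = (Z * B)`_(r + q - j).
Proof.
move=> sZ sB jrq; rewrite coefM /ccoef.
(* The common form of both convolutions, summed over the indices of Z. *)
pose T k := if (k <= j)%N && (j - k <= q)%N then Z`_(r - k) * B`_(q - (j - k))
  else 0.
transitivity (\sum_(0 <= k < r.+1) T k).
  rewrite (big_nat_widen _ _ (maxn j r).+1) ?ltnS ?leq_maxl //.
  rewrite [RHS](big_nat_widen _ _ (maxn j r).+1) ?ltnS ?leq_maxr //.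
  rewrite [LHS]big_mkcond [RHS]big_mkcond; apply: eq_big_nat => k _ /=.
  rewrite !ltnS /T /dcoef; do 3!case: leqP => //= ?; rewrite ?mulr0 ?mul0r //.
rewrite big_nat_rev /= -(big_mkord xpredT (fun i => Z`_i * B`_(r + q - j - i))).
rewrite (big_nat_widen _ _ (maxn (r + q - j) r).+1) ?ltnS ?leq_maxr //.
rewrite [RHS](big_nat_widen _ _ (maxn (r + q - j) r).+1) ?ltnS ?leq_maxl //.
rewrite [LHS]big_mkcond [RHS]big_mkcond; apply: eq_big_nat => i _ /=.
rewrite add0n subSS !ltnS /T; have [ir|ir] := leqP i r; last first.
  by rewrite (nth_default 0 (leq_trans sZ ir)) mul0r if_same.
have [h1|h1] /= := leqP (r - i) j; last first.
  case: ifP => // h; rewrite (nth_default 0 (leq_trans sB _)) ?mulr0 //; lia.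
have [h2|h2] := leqP (j - (r - i)) q; last by rewrite ifF //; lia.
rewrite ifT; last by lia.
by congr (Z`_ _ * B`_ _); lia.
Qed.

(** * Chebyshev expansions in powers of the squared sine *)

Section Chebyshev.
Variable F : numFieldType.
Implicit Types (q w x y i : F).

(** The Chebyshev polynomial U_(n-1) at 1 + w/2, in powers of w. For
    w = -4 sin^2 t it is sin 2nt / sin 2t. *)
Definition cheb (n : nat) w : F :=
  \sum_(0 <= b < n) 'C(n + b, 2 * b + 1)%:R * w ^+ b.

Lemma cheb_widen n N w : (n <= N)%N ->
  cheb n w = \sum_(0 <= b < N) 'C(n + b, 2 * b + 1)%:R * w ^+ b.
Proof.
move=> nN; rewrite /cheb (big_nat_widen _ _ _ _ _ nN) big_mkcond.
apply: eq_big_nat => b _ /=; case: ltnP => // nb.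
by rewrite bin_small ?mul0r //; lia.
Qed.

(** In terms of w = q + 1/q - 2 this is the three-term recurrence of q^n - q^(-n);
    coefficientwise it is Pascal's rule applied twice. *)
Lemma chebSS n w : cheb n.+2 w = (2 + w) * cheb n.+1 w - cheb n w.
Proof.
rewrite (cheb_widen n n.+2) ?(leq_trans _ (leqnSn _)) //.
rewrite [in RHS]mulrDl (cheb_widen n.+1 n.+2) // /cheb.
suff -> : w * (\sum_(0 <= b < n.+2) 'C(n.+1 + b, 2 * b + 1)%:R * w ^+ b)
    = \sum_(0 <= b < n.+2) ('C(n.+2 + b, 2 * b + 1)%:R
        - 2 * 'C(n.+1 + b, 2 * b + 1)%:R + 'C(n + b, 2 * b + 1)%:R) * w ^+ b.
  rewrite mulr_sumr -big_split -sumrB; apply: eq_bigr => b _ /=; ring.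
rewrite big_nat_recr //= (_ : 'C(_, 2 * n.+1 + 1) = 0%N) ?mul0r ?addr0;
  last first.
  by rewrite bin_small //; lia.
rewrite [RHS]big_nat_recl // big_distrr /= !muln0 !add0n !addn0 !bin1.
rewrite [X in _ = X + _](_ : _ = 0) ?add0r; last first.
  by rewrite expr0 mulr1 -!natr1; ring.
apply: eq_bigr => b _; rewrite exprS mulrCA; congr (_ * _).
rewrite (_ : (n.+2 + b.+1 = (n + b.+1).+2)%N); last by lia.
rewrite (_ : (n.+1 + b.+1 = (n + b.+1).+1)%N); last by lia.
rewrite (_ : (n.+1 + b = n + b.+1)%N); last by lia.
rewrite (_ : (2 * b.+1 + 1 = (2 * b + 1).+2)%N); last by lia.
rewrite !binS !natrD; ring.
Qed.

Lemma cheb_sub q q' w n : q * q' = 1 -> w = q + q' - 2 ->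
  q ^+ n - q' ^+ n = (q - q') * cheb n w.
Proof.
move=> qq wE; suff: q ^+ n - q' ^+ n = (q - q') * cheb n w /\
    q ^+ n.+1 - q' ^+ n.+1 = (q - q') * cheb n.+1 w by case.
elim: n => [|n [IH1 IH2]].
  by rewrite /cheb big_nil big_nat1 muln0 !add0n !addn0 bin1 mulr0 !mulr1;
    split=> //; rewrite !expr0 subrr.
split=> //; rewrite chebSS mulrBr mulrCA -IH1 -IH2 wE !exprS.
apply/eqP; rewrite -subr_eq0; apply/eqP.
transitivity ((1 - q * q') * (q ^+ n - q' ^+ n));
  last by rewrite qq subrr mul0r.
ring.
Qed.

(** In trigonometric form, 2 cos 2nt sin 2t = sin 2(n+1)t - sin 2(n-1)t. Dividing by
    sin 2t would lose the angles where it vanishes, so both sides are shown to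
    satisfy the same recurrence. *)
Lemma cheb_add q q' w n : q * q' = 1 -> w = q + q' - 2 ->
  q ^+ n.+1 + q' ^+ n.+1 = cheb n.+2 w - cheb n w.
Proof.
move=> qq wE; have two : 2 + w = q + q' by rewrite wE; ring.
suff: q ^+ n.+1 + q' ^+ n.+1 = cheb n.+2 w - cheb n w /\
    q ^+ n.+2 + q' ^+ n.+2 = cheb n.+3 w - cheb n.+1 w by case.
have c0 : cheb 0 w = 0 by rewrite /cheb big_nil.
have c1 : cheb 1 w = 1 by rewrite /cheb big_nat1 bin1 mulr1.
elim: n => [|n [IH1 IH2]].
  rewrite !chebSS c0 c1 two; split; first by rewrite !expr1; ring.
  apply/eqP; rewrite -subr_eq0; apply/eqP.
  by transitivity (2 * (1 - q * q')); [ring|rewrite qq subrr mulr0].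
split=> //; rewrite [cheb n.+4 w]chebSS [cheb n.+2 w in X in _ - X]chebSS.
have -> : (2 + w) * cheb n.+3 w - cheb n.+2 w - ((2 + w) * cheb n.+1 w - cheb n
  w)
    = (2 + w) * (cheb n.+3 w - cheb n.+1 w) - (cheb n.+2 w - cheb n w) by ring.
rewrite -IH1 -IH2 two !exprS; apply/eqP; rewrite -subr_eq0; apply/eqP.
transitivity ((1 - q * q') * (q * q ^+ n + q' * q' ^+ n));
  last by rewrite qq subrr mul0r.
ring.
Qed.

(** With N = al + k, the difference is C(N,2k) + C(N-1,2k), and
    N C(N-1,2k) = (N - 2k) C(N,2k). This is where the fraction al/(2 al - be)
    of M_1 comes from. *)
Lemma bin_sub_frac al k : (0 < al)%N -> (k <= al)%N ->
  'C(al.+1 + k, 2 * k + 1)%:R - 'C(al.-1 + k, 2 * k + 1)%:R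
  = 2 * (al%:R / (al + k)%N%:R) * 'C(al + k, 2 * k)%:R :> F.
Proof.
case: al => // a _ ka.
have -> : (a.+2 + k = (a + k).+2)%N by lia.
have -> : (a.+1 + k = (a + k).+1)%N by lia.
have -> : 'C((a + k).+2, 2 * k + 1)%:R - 'C(a.+1.-1 + k, 2 * k + 1)%:R
    = 'C((a + k).+1, 2 * k)%:R + 'C(a + k, 2 * k)%:R :> F.
  by rewrite addn1 !binS !natrD /=; ring.
have h : (a + k).+1%:R != 0 :> F by rewrite pnatr_eq0.
apply: (mulfI h); rewrite mulrDr -[X in _ + X]natrM.
have /= -> := mul_bin_down (a + k).+1 (2 * k).
rewrite natrM natrB; last by lia.
rewrite !natrM -!natr1 !natrD; field.
by rewrite -natrD natr1.
Qed.

(** The expansion of cos 2nt in powers of -4 sin^2 t, in the form used in M_1. *)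
Lemma cheb_add_frac q q' w n : (0 < n)%N -> q * q' = 1 -> w = q + q' - 2 ->
  (q ^+ n + q' ^+ n) / 2 =
  \sum_(0 <= b < n.+1) n%:R / (2 * n - b)%N%:R * 'C(2 * n - b, b)%:R * w ^+ (n
    - b).
Proof.
case: n => // n _ qq wE; rewrite (cheb_add _ _ _ _ qq wE).
rewrite (cheb_widen n n.+2) ?(leq_trans _ (leqnSn _)) // /cheb -sumrB.
rewrite [RHS]big_nat_rev mulr_suml /=; apply: eq_big_nat => b /andP[_ hb].
rewrite -mulrBl (bin_sub_frac n.+1 b) //.
rewrite add0n subSS subKn; last by lia.
rewrite (_ : (2 * n.+1 - (n.+1 - b) = n.+1 + b)%N); last by lia.
rewrite -(bin_sub (n := n.+1 + b) (m := 2 * b)); last by lia.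
rewrite (_ : (n.+1 + b - 2 * b = n.+1 - b)%N); last by lia.
by field; rewrite nat1r -natrD pnatr_eq0.
Qed.

End Chebyshev.

(** * The polynomial J in trigonometric form *)

Section SumJ.
Variable F : fieldType.
Implicit Types (x : F) (f : nat -> nat -> F).

Lemma sum_bin_sq x n N : (n < N)%N ->
  \sum_(0 <= g < N) 'C(n, g)%:R * x ^+ (2 * g) = (1 + x ^+ 2) ^+ n.
Proof.
move=> nN; rewrite exprDn -(big_mkord xpredT (fun i => 1 ^+ (n - i) * (x ^+ 2)
  ^+ i *+ 'C(n, i))).
rewrite (big_nat_widen _ _ _ _ _ nN) [RHS]big_mkcond /=.
apply: eq_big_nat => g _; rewrite ltnS; case: leqP => h.
  by rewrite expr1n mul1r -exprM mulr_natl.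
by rewrite bin_small // mul0r.
Qed.

(** The second and third sums of J split the pairs (ga, al) according to
    al < nu - ga or not. In the latter case the lower bound on be only discards
    terms whose binomial coefficient is zero, so together they are the binomial
    expansion of a single double sum. The argument [nu.+1] stands for p/2. *)
Lemma even_sum_merge x f nu :
  \sum_(0 <= g < nu.+1 - 1) (\sum_(1 <= al < nu.+1 - g) \sum_(0 <= be < al.+1)
      f al be * 'C(nu.+1 - al - 1 + be, g)%:R) * x ^+ (2 * g)
  + \sum_(1 <= g < nu.+1) (\sum_(nu.+1 - g <= al < nu.+1) \sum_(al + g + 1 -
    nu.+1 <= be < al.+1)
      f al be * 'C(nu.+1 - al - 1 + be, g)%:R) * x ^+ (2 * g)
  = \sum_(1 <= al < nu.+1) \sum_(0 <= be < al.+1)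
      f al be * (1 + x ^+ 2) ^+ (nu.+1 - al - 1 + be).
Proof.
pose t g al := \sum_(0 <= be < al.+1) f al be * 'C(nu.+1 - al - 1 + be, g)%:R *
  x ^+ (2 * g).
transitivity (\sum_(0 <= g < nu.+1) \sum_(1 <= al < nu.+1) t g al).
  rewrite [X in X + _](_ : _ = \sum_(0 <= g < nu.+1) \sum_(1 <= al < nu.+1 - g)
    t g al); last first.
    rewrite [RHS]big_nat_recr //= [X in _ = _ + X]big_geq ?addr0; last by lia.
    rewrite subn1 /=; apply: eq_big_nat => g _; rewrite mulr_suml.
    by apply: eq_big_nat => al _; rewrite /t mulr_suml.
  rewrite [X in _ + X](_ : _ = \sum_(0 <= g < nu.+1) \sum_(nu.+1 - g <= al <
    nu.+1) t g al); last first.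
    rewrite [RHS]big_ltn // [X in _ = X + _]big_geq ?add0r; last by lia.
    apply: eq_big_nat => g /andP[g0 gn]; rewrite mulr_suml.
    apply: eq_big_nat => al /andP[al1 al2]; rewrite mulr_suml /t.
    rewrite [RHS](big_cat_nat _ (n := (al + g + 1 - nu.+1)%N)) //=; last by lia.
    rewrite [X in _ = X + _]big1_seq ?add0r // => be;
      rewrite mem_index_iota => /andP[_ h].
    by rewrite bin_small ?mulr0 ?mul0r //; lia.
  rewrite -big_split; apply: eq_big_nat => g /andP[_ h] /=.
  case: g h => [|g] h.
    by rewrite subn0 [X in _ + X]big_geq // addr0.
  by rewrite -big_cat_nat //=; lia.
rewrite exchange_big_nat; apply: eq_big_nat => al /andP[al0 al1].
rewrite exchange_big_nat; apply: eq_big_nat => be /andP[_ beal] /=.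
rewrite -(@sum_bin_sq x _ nu.+1); last by lia.
by rewrite mulr_sumr; apply: eq_bigr => g _; rewrite mulrA.
Qed.

(** The analogue for the fourth and fifth sums, where the bounds on be agree. *)
Lemma odd_sum_merge x f nu :
  \sum_(0 <= g < nu.+1 - 1) (\sum_(1 <= al < nu.+1 - g) \sum_(0 <= be < al)
      f al be * 'C(nu.+1 - 2 - be, g)%:R) * x ^+ (2 * g + 1)
  + \sum_(1 <= g < nu.+1 - 1) (\sum_(nu.+1 - g <= al < nu.+1) \sum_(0 <= be <
    al)
      f al be * 'C(nu.+1 - 2 - be, g)%:R) * x ^+ (2 * g + 1)
  = \sum_(1 <= al < nu.+1) \sum_(0 <= be < al)
      f al be * (x * (1 + x ^+ 2) ^+ (nu.+1 - 2 - be)).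
Proof.
pose t g al := \sum_(0 <= be < al) f al be * 'C(nu.+1 - 2 - be, g)%:R * x ^+ (2
  * g + 1).
transitivity (\sum_(0 <= g < nu.+1 - 1) \sum_(1 <= al < nu.+1) t g al).
  rewrite [X in X + _](_ : _ = \sum_(0 <= g < nu.+1 - 1) \sum_(1 <= al < nu.+1
    - g) t g al); last first.
    apply: eq_big_nat => g _; rewrite mulr_suml.
    by apply: eq_big_nat => al _; rewrite /t mulr_suml.
  rewrite [X in _ + X](_ : _ = \sum_(0 <= g < nu.+1 - 1) \sum_(nu.+1 - g <= al
    < nu.+1) t g al); last first.
    case: nu @t => [|nu] t; first by rewrite !big_geq.
    rewrite [RHS]big_ltn // [X in _ = X + _]big_geq ?add0r; last by lia.
    apply: eq_big_nat => g _; rewrite mulr_suml.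
    by apply: eq_big_nat => al _; rewrite /t mulr_suml.
  rewrite -big_split; apply: eq_big_nat => g /andP[_ h] /=.
  case: g h => [|g] h.
    by rewrite subn0 [X in _ + X]big_geq // addr0.
  by rewrite -big_cat_nat //=; lia.
rewrite exchange_big_nat; apply: eq_big_nat => al /andP[al0 al1].
rewrite exchange_big_nat; apply: eq_big_nat => be /andP[_ beal] /=.
rewrite -(@sum_bin_sq x _ (nu.+1 - 1)); last by lia.
by rewrite !mulr_sumr; apply: eq_bigr => g _; rewrite addn1 exprS; ring.
Qed.

End SumJ.

(** The imaginary unit enters the algebra only through this relation, so that
    it can be kept abstract. *)
Lemma sqrN1_neq0 (F : fieldType) (i : F) : i * i = -1 -> i != 0.
Proof.
move=> i2; apply/eqP => i0; move/eqP: i2.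
by rewrite i0 mul0r eq_sym oppr_eq0 oner_eq0.
Qed.

Section TrigForm.
Variable F : numFieldType.
Variable i : F.
Hypothesis i2 : i * i = -1.
Implicit Types (e : F) (c : nat -> F).

(** Up to the factor 2^(-s), the coefficient of exp(i(2x - s)t) in
    sum_j c_j cos^(s-j) t sin^j t. *)
Definition tcoef (s : nat) c (x : nat) : F :=
  \sum_(0 <= j < s.+1) c j * (- i) ^+ j * (Tsum x j (s - j))%:~R.

(** With e = exp(it) and e' = exp(-it), the two quotients are cos t and sin t. *)
Lemma tcoef_generating s c e e' :
  \sum_(0 <= j < s.+1) c j * (((e + e') / 2) ^+ (s - j) * ((e - e') / (2 * i))
    ^+ j)
  = (2 ^+ s)^-1 * \sum_(0 <= x < s.+1) tcoef s c x * (e ^+ x * e' ^+ (s - x)).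
Proof.
have i0 := sqrN1_neq0 F i i2.
have iV : i^-1 = - i by apply: (mulfI i0); rewrite mulfV // mulrN i2 opprK.
transitivity ((2 ^+ s)^-1 * \sum_(0 <= x < s.+1) \sum_(0 <= j < s.+1)
   c j * (- i) ^+ j * (Tsum x j (s - j))%:~R * (e ^+ x * e' ^+ (s - x)));
     last first.
  by congr (_ * _); apply: eq_bigr => x _; rewrite mulr_suml.
rewrite exchange_big_nat mulr_sumr; apply: eq_big_nat => j /andP[_ hj] /=.
have := Tsum_generating F j (s - j) e e'; rewrite subnKC // => g.
transitivity (2 ^- s * (c j * (- i) ^+ j * ((e - e') ^+ j * (e + e') ^+ (s -
  j)))); last first.
  by congr (_ * _); rewrite -g mulr_sumr; apply: eq_bigr => x _;
    rewrite -!mulrA.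
rewrite !exprMn invfM exprMn iV exprVn exprVn.
have -> : 2 ^- s = 2 ^- (s - j) * 2 ^- j :> F.
  by rewrite -invfM -exprD subnK.
by ring.
Qed.

Lemma tcoef_split la c x :
  tcoef (2 * la) c x =
  \sum_(0 <= j < la.+1) (-1) ^+ j * c (2 * j)%N * (Tsum x (2 * j) (2 * la - 2 *
    j))%:~R
  - i * \sum_(0 <= j < la) (-1) ^+ j * c (2 * j + 1)%N * (Tsum x (2 * j + 1) (2
    * la - 2 * j - 1))%:~R.
Proof.
have i2j j : (- i) ^+ (2 * j) = (-1) ^+ j by rewrite exprM expr2 mulrNN i2.
rewrite /tcoef sum_even_odd.
rewrite (_ : uphalf (2 * la).+1 = la.+1); last by rewrite mul2n /= doubleK.
rewrite (_ : (2 * la).+1./2 = la); last by rewrite mul2n /= uphalf_double.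
rewrite mulr_sumr -sumrN; congr (_ + _); apply: eq_bigr => j _.
  by rewrite i2j; ring.
by rewrite exprD i2j subnDA; ring.
Qed.

(** By the symmetry of T, the values of T at la + k and la - k are equal for even j
    and opposite for odd j. Adding or subtracting them, as J does, therefore
    doubles the contribution to the cosine or to the sine. *)
Lemma tcoef_pair la c k q q' : (k <= la)%N ->
  tcoef (2 * la) c (la + k) * q + tcoef (2 * la) c (la - k) * q' =
  (\sum_(0 <= j < la.+1) (-1) ^+ j * c (2 * j)%N *
     (Tsum (la + k) (2 * j) (2 * la - 2 * j) + Tsum (la - k) (2 * j) (2 * la -
       2 * j))%:~R)
     * ((q + q') / 2)
  + (\sum_(0 <= j < la) (-1) ^+ j * c (2 * j + 1)%N *
     (Tsum (la + k) (2 * j + 1) (2 * la - 2 * j - 1)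
      - Tsum (la - k) (2 * j + 1) (2 * la - 2 * j - 1))%:~R) * ((q - q') / (2 *
        i)).
Proof.
move=> kla.
have i0 := sqrN1_neq0 F i i2.
have refl j : (j <= 2 * la)%N ->
    Tsum (la - k) j (2 * la - j) = (-1) ^+ j * Tsum (la + k) j (2 * la - j).
  by move=> hj; rewrite -Tsum_sym subnKC //; first [congr Tsum; lia | lia].
have even : \sum_(0 <= j < la.+1) (-1) ^+ j * c (2 * j)%N *
     (Tsum (la - k) (2 * j) (2 * la - 2 * j))%:~R
   = \sum_(0 <= j < la.+1) (-1) ^+ j * c (2 * j)%N *
     (Tsum (la + k) (2 * j) (2 * la - 2 * j))%:~R.
  apply: eq_big_nat => j hj; rewrite refl; last by lia.
  by rewrite exprM sqrrN !expr1n mul1r.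
have odd : \sum_(0 <= j < la) (-1) ^+ j * c (2 * j + 1)%N *
     (Tsum (la - k) (2 * j + 1) (2 * la - 2 * j - 1))%:~R
   = - \sum_(0 <= j < la) (-1) ^+ j * c (2 * j + 1)%N *
     (Tsum (la + k) (2 * j + 1) (2 * la - 2 * j - 1))%:~R.
  rewrite -sumrN; apply: eq_big_nat => j hj; rewrite -subnDA refl; last by lia.
  by rewrite exprD exprM sqrrN !expr1n mul1r expr1 mulN1r rmorphN /= mulrN.
rewrite !tcoef_split odd even.
under [in RHS]eq_bigr do rewrite rmorphD mulrDr.
rewrite [in RHS]big_split /= even.
under [X in _ = _ + X * _]eq_bigr do rewrite rmorphB mulrBr.
rewrite [in RHS]sumrB odd opprK.
set X := \sum_(0 <= j < la.+1) _; set Y := \sum_(0 <= j < la) _.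
have -> : (q - q') / (2 * i) = - i * (q - q') / 2.
  apply: (mulIf i0); rewrite -mulrA -mulrA invfM -(mulrA 2^-1) mulVf // mulr1.
  by rewrite (mulrC _ i) !mulrA mulrN -mulrA ?i2; ring: i2.
by field.
Qed.

(** At the central index the odd T vanish, being their own opposites. *)
Lemma tcoef_mid la c :
  tcoef (2 * la) c la =
  \sum_(0 <= j < la.+1) (-1) ^+ j * c (2 * j)%N * (Tsum la (2 * j) (2 * la - 2
    * j))%:~R.
Proof.
rewrite tcoef_split [X in _ - _ * X]big1_seq ?mulr0 ?subr0 // => j.
rewrite mem_index_iota => /andP[_ hj].
have := @Tsum_sym (2 * j + 1) (2 * la - (2 * j + 1)) la.
rewrite subnKC; last by lia.
rewrite (_ : (2 * la - la = la)%N); last by lia.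
rewrite exprD exprM sqrrN !expr1n mul1r expr1 mulN1r -subnDA => /(_ _) e.
by rewrite (_ : Tsum _ _ _ = 0) ?mulr0 //; lia.
Qed.

(** The factor of M_1 that does not depend on ga, summed over j. *)
Definition Jeven_coef m nu c (al be : nat) : F :=
  let s := (m * (2 * nu.+1) - 2)%N in let la := (m * nu.+1 - 1)%N in
  (\sum_(0 <= j < la.+1) (-1) ^+ j * c (2 * j)%N *
     (Tsum (la + al * m) (2 * j) (s - 2 * j)
      + Tsum (la - al * m) (2 * j) (s - 2 * j))%:~R)
  * ((-1) ^+ (al - be) * 2 ^+ (2 * (al - be)) * al%:R / (2 * al - be)%N%:R
     * 'C(2 * al - be, be)%:R).

(** The factor of M_2 that does not depend on ga, summed over j. *)
Definition Jodd_coef m nu c (al be : nat) : F :=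
  let s := (m * (2 * nu.+1) - 2)%N in let la := (m * nu.+1 - 1)%N in
  (\sum_(0 <= j < la) (-1) ^+ j * c (2 * j + 1)%N *
     (Tsum (la + al * m) (2 * j + 1) (s - 2 * j - 1)
      - Tsum (la - al * m) (2 * j + 1) (s - 2 * j - 1))%:~R)
  * ((-1) ^+ be * 2 ^+ (2 * be + 1) * 'C(al + be, 2 * be + 1)%:R).

Lemma exchange_big_nat3 (G : nat -> nat -> nat -> F) n a1 a2 (b1 b2 : nat ->
  nat) :
  \sum_(0 <= j < n) \sum_(a1 <= al < a2) \sum_(b1 al <= be < b2 al) G j al be
  = \sum_(a1 <= al < a2) \sum_(b1 al <= be < b2 al) \sum_(0 <= j < n) G j al be.
Proof.
rewrite exchange_big_nat; apply: eq_bigr => al _; exact: exchange_big_nat.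
Qed.

Lemma Jpoly_horner m nu c (x : F) : (0 < m)%N ->
  let p := (2 * nu.+1)%N in let s := (m * p - 2)%N in let la := (m * nu.+1 -
    1)%N in
  (Jpoly m p c).[x] = (2 ^+ s)^-1 *
  ((\sum_(0 <= j < la.+1) (-1) ^+ j * c (2 * j)%N * (Tsum la (2 * j) (s - 2 *
    j))%:~R)
     * (1 + x ^+ 2) ^+ nu
   + \sum_(1 <= al < nu.+1) \sum_(0 <= be < al.+1)
       Jeven_coef m nu c al be * (1 + x ^+ 2) ^+ (nu.+1 - al - 1 + be)
   + \sum_(1 <= al < nu.+1) \sum_(0 <= be < al)
       Jodd_coef m nu c al be * (x * (1 + x ^+ 2) ^+ (nu.+1 - 2 - be))).
Proof.
move=> m0 p s la.
have pE : (p %/ 2 = nu.+1)%N by rewrite /p mulKn.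
have sE : (s %/ 2 = la)%N.
  rewrite /s /p /la (_ : (m * (2 * nu.+1) - 2 = 2 * (m * nu.+1 - 1))%N) ?mulKn
    //.
  by rewrite mulnBr mulnCA.
have e1 ga a1 a2 (b1 : nat -> nat) :
    \sum_(0 <= j < la.+1) \sum_(a1 <= al < a2) \sum_(b1 al <= be < al.+1) M1 m
      p c j al be ga
    = \sum_(a1 <= al < a2) \sum_(b1 al <= be < al.+1)
        Jeven_coef m nu c al be * 'C(nu.+1 - al - 1 + be, ga)%:R.
  rewrite exchange_big_nat3; apply: eq_bigr => al _; apply: eq_bigr => be _.
  rewrite /Jeven_coef -/p -/s -/la !mulr_suml; apply: eq_bigr => j _.
  by rewrite /M1 -/s pE sE exprD; ring.
have e2 ga a1 a2 :
    \sum_(0 <= j < la) \sum_(a1 <= al < a2) \sum_(0 <= be < al) M2 m p c j al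
      be ga
    = \sum_(a1 <= al < a2) \sum_(0 <= be < al)
        Jodd_coef m nu c al be * 'C(nu.+1 - 2 - be, ga)%:R.
  rewrite (exchange_big_nat3 _ _ _ _ (fun=> 0%N) id); apply: eq_bigr => al _;
    apply: eq_bigr => be _.
  rewrite /Jodd_coef -/p -/s -/la !mulr_suml; apply: eq_bigr => j _.
  by rewrite /M2 -/s pE sE exprD; ring.
rewrite -even_sum_merge -odd_sum_merge -(@sum_bin_sq _ x nu nu.+1) // /Jpoly
  -/s pE sE.
rewrite !hornerD !hornerZ !horner_sum !mulrDr !addrA.
congr (_ + _ + _ + _ + _); congr (_ * _); rewrite ?mulr_sumr;
  apply: eq_bigr => ga _;
  rewrite hornerZ hornerXn.
- by rewrite subn1 /=; ring.
- by rewrite (e1 _ _ _ (fun=> 0%N)).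
- by rewrite (e1 _ _ _ (fun al => (al + ga + 1 - nu.+1)%N)).
- by rewrite e2.
- by rewrite e2.
Qed.

(** Here e = exp(it), e' = exp(-it), C = cos t and S = sin t. Multiplication by
    S^(2 nu) = (1 + (C/S)^2)^(-nu) turns the powers of 1 + x^2 in J into powers of
    sin^2 t, and the Chebyshev expansions sum up to cosines and sines. *)
Lemma Jpoly_trig m nu c (e e' : F) : (0 < m)%N -> e * e' = 1 ->
  let p := (2 * nu.+1)%N in let s := (m * p - 2)%N in
  let C := (e + e') / 2 in let S := (e - e') / (2 * i) in S != 0 ->
  S ^+ (2 * nu) * (Jpoly m p c).[C / S] = (2 ^+ s)^-1 *
  \sum_(0 <= j < p) (if (m * j)%N is k.+1 then tcoef s c k else 0)
     * (e ^+ (2 * j) * e' ^+ p).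
Proof.
move=> m0 ee p s C S S0; rewrite Jpoly_horner // -/p -/s mulrCA; congr (_ * _).
set la := (m * nu.+1 - 1)%N.
have mn : (0 < m * nu.+1)%N by rewrite muln_gt0 m0.
have sE : s = (2 * la)%N by rewrite /s /p /la mulnBr mulnCA.
have i0 := sqrN1_neq0 F i i2.
pose q := e ^+ 2; pose q' := e' ^+ 2; pose w := q + q' - 2.
have qq : q * q' = 1 by rewrite -exprMn ee expr1n.
have S2 : w = - (4 * S ^+ 2).
  rewrite /w /S /q /q' exprMn exprVn exprMn (expr2 i) i2.
  transitivity (e ^+ 2 + e' ^+ 2 - 2 * (e * e')); first by rewrite ee; ring.
  by field.
have wX k : w ^+ k = (-1) ^+ k * (2 ^+ (2 * k) * (S ^+ 2) ^+ k).
  have four : 4 = 2 ^+ 2 :> F by ring.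
  rewrite (_ : w = -1 * (2 ^+ 2 * S ^+ 2)); last by rewrite S2 mulN1r four.
  by rewrite exprMn [X in _ * X = _]exprMn (exprM _ 2 k).
set z := 1 + (C / S) ^+ 2.
have zS : S ^+ 2 * z = 1.
  rewrite /z mulrDr mulr1 -exprMn mulrCA mulfV // mulr1.
  transitivity (e * e'); last exact: ee.
  by rewrite /S /C !exprMn !exprVn exprMn (expr2 i) i2; field.
have powS k n : (k <= n)%N -> S ^+ (2 * n) * z ^+ (n - k) = (S ^+ 2) ^+ k.
  move=> kn; rewrite exprM -{1}(subnK kn) exprD mulrAC -exprMn zS expr1n mul1r
    //.
have evenS al : (0 < al)%N -> (al <= nu)%N -> S ^+ (2 * nu) * (\sum_(0 <= be <
  al.+1)
     Jeven_coef m nu c al be * z ^+ (nu.+1 - al - 1 + be))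
   = (\sum_(0 <= j < la.+1) (-1) ^+ j * c (2 * j)%N *
     (Tsum (la + al * m) (2 * j) (s - 2 * j)
      + Tsum (la - al * m) (2 * j) (s - 2 * j))%:~R) * ((q ^+ al + q' ^+ al) /
        2).
  move=> al0 aln; rewrite (@cheb_add_frac _ q q' w) // !mulr_sumr.
  apply: eq_big_nat => be /andP[_ hbe]; rewrite /Jeven_coef -/p -/s -/la.
  rewrite (_ : (nu.+1 - al - 1 + be = nu - (al - be))%N); last by lia.
  rewrite mulrCA powS; last by lia.
  rewrite -!mulrA; congr (_ * _).
  by rewrite wX; ring.
have oddS al : (0 < al)%N -> (al <= nu)%N -> S ^+ (2 * nu) * (\sum_(0 <= be <
  al)
     Jodd_coef m nu c al be * (C / S * z ^+ (nu.+1 - 2 - be)))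
   = (\sum_(0 <= j < la) (-1) ^+ j * c (2 * j + 1)%N *
     (Tsum (la + al * m) (2 * j + 1) (s - 2 * j - 1)
      - Tsum (la - al * m) (2 * j + 1) (s - 2 * j - 1))%:~R)
     * ((q ^+ al - q' ^+ al) / (2 * i)).
  move=> al0 aln; rewrite (@cheb_sub _ q q' w) //.
  have -> : (q - q') * cheb F al w / (2 * i) = 2 * (C * S) * cheb F al w.
    by rewrite /C /S /q /q'; field.
  rewrite /cheb !mulr_sumr; apply: eq_big_nat => be /andP[_ hbe].
  rewrite /Jodd_coef -/p -/s -/la (_ : (nu.+1 - 2 - be = nu - be.+1)%N);
    last by lia.
  rewrite mulrCA (mulrCA _ (C / S)) powS; last by lia.
  rewrite -[LHS]mulrA; congr (_ * _).
  rewrite wX (exprS (S ^+ 2) be) (exprD 2 (2 * be) 1) expr1.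
  by field.
transitivity (tcoef s c la + \sum_(1 <= al < nu.+1)
   (tcoef s c (la + al * m) * q ^+ al + tcoef s c (la - al * m) * q' ^+ al)).
  rewrite !mulrDr mulrCA -[X in z ^+ X](subn0 nu) powS // expr0 mulr1 -addrA.
  rewrite sE tcoef_mid -sE; congr (_ + _).
  rewrite [X in X + _]mulr_sumr [X in _ + X]mulr_sumr -big_split;
    apply: eq_big_nat => al /andP[a0 an] /=.
  rewrite evenS // oddS // sE tcoef_pair //.
  rewrite /la; have : (m * al <= m * nu)%N by rewrite leq_mul.
  rewrite mulnS (mulnC al); lia.
rewrite /p sum_centered muln0 mul0r add0r.
have mE k : (0 < m * k)%N -> (m * k = (m * k - 1).+1)%N by lia.
congr (_ + _).
  by rewrite -exprMn ee expr1n mulr1 (mE _ mn).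
apply: eq_big_nat => al /andP[a0 an]; congr (_ + _).
  rewrite (mE (nu.+1 + al)%N) ?muln_gt0 ?m0 //.
  rewrite (_ : (m * (nu.+1 + al) - 1 = la + al * m)%N); last first.
    by rewrite /la mulnDr (mulnC al); lia.
  by rewrite mulnDr exprD mulrAC -exprMn ee expr1n mul1r /q -exprM.
have h : (0 < nu.+1 - al)%N by rewrite subn_gt0.
rewrite (mE (nu.+1 - al)%N) ?muln_gt0 ?m0 //.
rewrite (_ : (m * (nu.+1 - al) - 1 = la - al * m)%N); last first.
  by rewrite /la mulnBr (mulnC al); lia.
rewrite (_ : (2 * nu.+1 = 2 * (nu.+1 - al) + 2 * al)%N); last by lia.
congr (_ * _); rewrite [e' ^+ _]exprD mulrA -exprMn ee expr1n mul1r /q' -exprM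
  //.
Qed.

End TrigForm.

(** * The polynomials P_m, Q_m, E and H *)

Section PQ.
Variable F : fieldType.
Implicit Types (x i a : F) (xs ys : seq F).

(** The even and odd terms of the binomial expansion. With [- i] for [i] it also
    gives (x - i)^m. *)
Lemma Ppoly_Qpoly_expr i x m : i * i = -1 -> (0 < m)%N ->
  (Ppoly F m).[x] + i * (Qpoly F m).[x] = (x + i) ^+ m.
Proof.
move=> i2 m0; rewrite exprDn.
rewrite -(big_mkord xpredT (fun k => x ^+ (m - k) * i ^+ k *+ 'C(m, k))).
rewrite sum_even_odd (_ : uphalf m.+1 = (m %/ 2).+1); last by rewrite divn2.
rewrite (_ : m.+1./2 = ((m - 1) %/ 2).+1); last by case: m m0 => // m _;
  rewrite subn1 divn2.
have ie k : i ^+ (2 * k) = (-1) ^+ k by rewrite exprM expr2 i2.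
congr (_ + _); rewrite /Ppoly /Qpoly horner_sum ?mulr_sumr;
  apply: eq_bigr => k _.
  by rewrite hornerZ hornerXn ie -mulr_natr; ring.
by rewrite hornerZ hornerXn exprD ie -mulr_natr; ring.
Qed.

Lemma size_Ppoly m : (size (Ppoly F m) <= m.+1)%N.
Proof.
rewrite /Ppoly big_mkord (leq_trans (size_sum _ _ _)) //;
  apply/bigmax_leqP => k _.
by rewrite (leq_trans (size_scale_leq _ _)) // size_polyXn ltnS leq_subr.
Qed.

Lemma size_Qpoly m : (size (Qpoly F m) <= m.+1)%N.
Proof.
rewrite /Qpoly big_mkord (leq_trans (size_sum _ _ _)) //;
  apply/bigmax_leqP => k _.
by rewrite (leq_trans (size_scale_leq _ _)) // size_polyXn ltnS leq_subr.
Qed.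

Lemma map_prod_XsubC (S : comNzRingType) (phi : {rmorphism F -> S}) ys :
  map_poly phi (\prod_(y <- ys) ('X - y%:P)) = \prod_(y <- map phi ys) ('X -
    y%:P).
Proof.
elim: ys => [|y ys IH]; first by rewrite !big_nil rmorph1.
by rewrite !big_cons rmorphM /= map_polyXsubC IH.
Qed.

(** The signs (-1)^l in e_l and sigma_l cancel, and the factor Q_m(x_j) clears the
    denominator of R_m(x_j). A morphism is allowed so that the same computation
    serves E, where U and V are polynomials, and H, where they are scalars. *)
Lemma ecoef_homogenize (S : comNzRingType) (phi : {rmorphism F -> S}) (a0 : F)
  m xs (U V : S) :
  all (fun x => (Qpoly F m).[x] != 0) xs ->
  \sum_(0 <= l < (size xs).+1) phi (ecoef a0 m xs l) * (U ^+ (size xs - l) * V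
    ^+ l)
  = phi a0 ^+ m * \prod_(x <- xs) (phi (Qpoly F m).[x] * U - phi (Ppoly F
    m).[x] * V).
Proof.
move=> Q0; set P := Ppoly F m; set Q := Qpoly F m in Q0 *.
have -> : \prod_(x <- xs) (phi Q.[x] * U - phi P.[x] * V)
    = phi (\prod_(x <- xs) Q.[x]) * \prod_(x <- xs) (U - phi (Rfrac m x) * V).
  rewrite rmorph_prod -big_split /=; apply: eq_big_seq => x /(allP Q0) Qx.
  by rewrite mulrBr mulrA -rmorphM /= /Rfrac mulrCA mulfV // mulr1.
have -> : \prod_(x <- xs) (U - phi (Rfrac m x) * V)
    = \prod_(y <- [seq phi (Rfrac m x) | x <- xs]) (U - y * V) by rewrite
      big_map.
rewrite -homogenize_prod size_map mulrA mulr_sumr big_nat_rev /=.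
apply: eq_big_nat => l /andP[_ hl]; rewrite add0n subSS subKn // mulrA.
rewrite /ecoef /Defs.esym size_map /dcoef leq_subr subKn //.
have -> : [seq phi (Rfrac m x) | x <- xs] = map phi [seq Rfrac m x | x <- xs].
  by rewrite -map_comp.
rewrite -map_prod_XsubC coef_map.
rewrite !rmorphM /= !rmorphXn /= rmorphN1 -/Q.
set s := (-1) ^+ _; have ss : s * s = 1 by rewrite -expr2 sqrr_sign.
by ring: ss.
Qed.

Section Divisibility.
Variables (a0 : F) (m : nat) (xs ys : seq F).
Hypothesis Q0 : all (fun x => (Qpoly F m).[x] != 0) xs.
Let P := Ppoly F m.
Let Q := Qpoly F m.

Lemma Epoly_prod : Epoly a0 m (size xs) xs =
  (a0 ^+ m)%:P * \prod_(x <- xs) (Q.[x] *: P - P.[x] *: Q).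
Proof.
have := ecoef_homogenize _ (@polyC F) a0 m xs P Q Q0.
rewrite -polyC_exp => e; rewrite /Epoly.
transitivity ((a0 ^+ m)%:P * \prod_(x <- xs) (Q.[x]%:P * P - P.[x]%:P * Q)).
  by rewrite -e; apply: eq_bigr => l _; rewrite mul_polyC.
by congr (_ * _); apply: eq_bigr => x _; rewrite !mul_polyC.
Qed.

Lemma Epoly_horner u : (Epoly a0 m (size xs) xs).[u] =
  a0 ^+ m * \prod_(x <- xs) (Q.[x] * P.[u] - P.[x] * Q.[u]).
Proof.
rewrite Epoly_prod hornerM hornerC horner_prod; congr (_ * _).
by apply: eq_bigr => x _; rewrite hornerD hornerN !hornerZ.
Qed.

Lemma Hpoly_horner u : (Hpoly a0 m (size xs) xs).[u] =
  a0 ^+ m * \prod_(x <- xs) (Q.[x] * u - P.[x]).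
Proof.
have := ecoef_homogenize _ idfun a0 m xs u 1 Q0.
rewrite /= => e; rewrite /Hpoly horner_sum.
transitivity (a0 ^+ m * \prod_(x <- xs) (Q.[x] * u - P.[x] * 1)).
  by rewrite -e; apply: eq_bigr => l _; rewrite hornerZ hornerXn expr1n mulr1.
by congr (_ * _); apply: eq_bigr => x _; rewrite mulr1.
Qed.

(** The factor of E belonging to x_j vanishes at x_j, which accounts for
    multiplicities as well. *)
Lemma dvd_Epoly (A : {poly F}) : A = lead_coef A *: \prod_(x <- xs) ('X - x%:P)
  ->
  A != 0 -> A %| Epoly a0 m (size xs) xs.
Proof.
move=> AE A0; rewrite AE dvdpZl ?lead_coef_eq0 // Epoly_prod dvdp_mull //.
elim: xs => [|x s IH]; first by rewrite !big_nil.
rewrite !big_cons dvdp_mul // dvdp_XsubCl /root hornerD hornerN !hornerZ.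
by rewrite mulrC subrr.
Qed.

Lemma size_Epoly : (size (Epoly a0 m (size xs) xs) <= (m * size xs).+1)%N.
Proof.
rewrite Epoly_prod mul_polyC (leq_trans (size_scale_leq _ _)) //.
elim: xs => [|x s IH]; first by rewrite big_nil size_poly1.
rewrite big_cons /= (leq_trans (size_polyMleq _ _)) //.
have : (size (Q.[x] *: P - P.[x] *: Q)%R <= m.+1)%N.
  rewrite (leq_trans (size_polyD _ _)) // geq_max size_polyN.
  by rewrite !(leq_trans (size_scale_leq _ _)) // ?size_Ppoly ?size_Qpoly.
move=> h; have := leq_add h IH; rewrite mulnS addSn addnS.
by case: (size _ + _)%N => [|k] /=; rewrite ?ltnS.
Qed.

End Divisibility.
End PQ.

(** * Evaluation at a cotangent *)

Section Cot.
Variable F : numFieldType.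
Variable i : F.
Hypothesis i2 : i * i = -1.

Lemma prodr_scale (I : Type) (s : seq I) (G : I -> F) (k : F) :
  \prod_(x <- s) (G x * k) = \prod_(x <- s) G x * k ^+ size s.
Proof.
elim: s => [|x s IH]; first by rewrite !big_nil mulr1.
by rewrite !big_cons IH exprS; ring.
Qed.

(** De Moivre's formula: S (x + i) = e and S (x - i) = e' for x = C/S. *)
Lemma Ppoly_Qpoly_cot (e e' : F) m : (0 < m)%N ->
  let C := (e + e') / 2 in let S := (e - e') / (2 * i) in S != 0 ->
  (Ppoly F m).[C / S] * S ^+ m = (e ^+ m + e' ^+ m) / 2
  /\ (Qpoly F m).[C / S] * S ^+ m = (e ^+ m - e' ^+ m) / (2 * i).
Proof.
move=> m0 C S S0.
have i0 := sqrN1_neq0 F i i2.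
have Sp : S * (C / S + i) = e.
  rewrite mulrDr mulrCA mulfV // mulr1 /C /S; by field.
have Sm : S * (C / S + - i) = e'.
  rewrite mulrDr mulrCA mulfV // mulr1 /C /S; by field.
have i2' : (- i) * (- i) = -1 by rewrite mulrNN.
have ep : e ^+ m = S ^+ m * ((Ppoly F m).[C / S] + i * (Qpoly F m).[C / S]).
  by rewrite (Ppoly_Qpoly_expr _ _ _ _ i2 m0) -exprMn Sp.
have em : e' ^+ m = S ^+ m * ((Ppoly F m).[C / S] + - i * (Qpoly F m).[C / S]).
  by rewrite (Ppoly_Qpoly_expr _ _ _ _ i2' m0) -exprMn Sm.
rewrite ep em; set T := S ^+ m; set P := (Ppoly F m).[_];
  set Q := (Qpoly F m).[_].
by split; field.
Qed.

(** The shift by one makes the frequencies that survive the decimation those whose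
    index is divisible by m: the centre s/2 + 1 = mp/2 is. *)
Lemma cot_numerator n s c (e e' : F) : n = s.+2 -> e * e' = 1 ->
  \sum_(0 <= k < n) (if k is k'.+1 then tcoef F i s c k' else 0)
     * (e ^+ (2 * k) * e' ^+ n)
  = 2 ^+ s * \sum_(0 <= j < s.+1)
     c j * (((e + e') / 2) ^+ (s - j) * ((e - e') / (2 * i)) ^+ j).
Proof.
move=> -> ee; rewrite (tcoef_generating _ _ i2) mulrA mulfV ?expf_neq0
  ?pnatr_eq0 // mul1r.
rewrite big_nat_recl // mul0r add0r; apply: eq_big_nat => k /andP[_ hk].
congr (_ * _); rewrite (_ : (2 * k.+1 = k + k.+2)%N); last by lia.
rewrite (_ : s.+2 = (s - k + k.+2)%N); last by lia.
by rewrite exprD [e' ^+ _]exprD mulrACA -exprMn ee expr1n mulr1.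
Qed.

Lemma horner_rev s (p : {poly F}) (C S : F) : S != 0 -> (size p <= s.+1)%N ->
  p.[C / S] * S ^+ s = \sum_(0 <= j < s.+1) p`_(s - j) * (C ^+ (s - j) * S ^+
    j).
Proof.
move=> S0 sp; rewrite (horner_coef_wide _ sp) mulr_suml.
rewrite -(big_mkord xpredT (fun k => p`_k * (C / S) ^+ k * S ^+ s)) big_nat_rev
  /=.
apply: eq_big_nat => j /andP[_ hj]; rewrite add0n subSS -mulrA; congr (_ * _).
rewrite -{2}(subnK (_ : j <= s)%N) // exprD mulrA -exprMn mulfVK //.
Qed.

End Cot.

Local Open Scope classical_set_scope.
Local Open Scope ring_scope.
Local Open Scope complex_scope.

(** * Complex numbers by components, and the non-real roots of A *)

Section Components.
Variable R : realType.
Implicit Types (v w : R[i]).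

Lemma complex_eqP v w :
  complex.Re v = complex.Re w -> complex.Im v = complex.Im w -> v = w.
Proof. by case: v w => [a b] [c d] /= -> ->. Qed.

Lemma Re_mulc v w : complex.Re (v * w) =
  complex.Re v * complex.Re w - complex.Im v * complex.Im w.
Proof. by case: v w => [a b] [c d]. Qed.

Lemma Im_mulc v w : complex.Im (v * w) =
  complex.Re v * complex.Im w + complex.Im v * complex.Re w.
Proof. by case: v w => [a b] [c d]. Qed.

Lemma Re_addc v w : complex.Re (v + w) = complex.Re v + complex.Re w.
Proof. by case: v w => [a b] [c d]. Qed.

Lemma Im_addc v w : complex.Im (v + w) = complex.Im v + complex.Im w.
Proof. by case: v w => [a b] [c d]. Qed.

Lemma Re_invc v : complex.Re v^-1 =
  complex.Re v / (complex.Re v ^+ 2 + complex.Im v ^+ 2).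
Proof. by case: v. Qed.

Lemma Im_invc v : complex.Im v^-1 =
  - complex.Im v / (complex.Re v ^+ 2 + complex.Im v ^+ 2).
Proof. by case: v => a b /=; rewrite mulNr. Qed.

End Components.

Section NonReal.
Variable R : realType.
Implicit Types (x z w : R[i]).

(* The squared modulus, as a real number. *)
Let n2 z : R := complex.Re z ^+ 2 + complex.Im z ^+ 2.
Let n2M z w : n2 (z * w) = n2 z * n2 w.
Proof. by rewrite /n2 Re_mulc Im_mulc; ring. Qed.
Let n2X z m : n2 (z ^+ m) = n2 z ^+ m.
Proof.
elim: m => [|m IH]; last by rewrite !exprS n2M IH.
by rewrite !expr0 /n2 /= expr0n addr0 expr1n.
Qed.

(** If Q u = P v with u, v real, then (P + iQ)(u - iv) = (P - iQ)(u + iv). Taking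
    absolute values, |x + i| = |x - i|, so x would be real. For u = 1, v = 0 this
    says that the zeros of Q_m are real, and in general that R_m maps non-real
    points to non-real points. *)
Lemma cot_factor_neq0 x m (u v : R) : (0 < m)%N -> complex.Im x != 0 ->
  u ^+ 2 + v ^+ 2 != 0 ->
  (Qpoly R[i] m).[x] * u%:C - (Ppoly R[i] m).[x] * v%:C != 0.
Proof.
move=> m0 x0 uv0; set P := (Ppoly _ _).[x]; set Q := (Qpoly _ _).[x].
apply/eqP => e.
have i2 : 'i * 'i = -1 :> R[i] by rewrite -expr2 sqr_i.
have i2' : (- 'i) * (- 'i) = -1 :> R[i] by rewrite mulrNN.
have ep := Ppoly_Qpoly_expr _ _ x m i2 m0.
have em := Ppoly_Qpoly_expr _ _ x m i2' m0.
have : (x + 'i) ^+ m * (u%:C - 'i * v%:C) = (x + - 'i) ^+ m * (u%:C + 'i *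
  v%:C).
  rewrite -ep -em -/P -/Q; apply/eqP; rewrite -subr_eq0; apply/eqP.
  transitivity (2 * 'i * (Q * u%:C - P * v%:C)); last by rewrite e mulr0.
  by ring.
move/(congr1 n2); rewrite !n2M !n2X.
have -> : n2 (u%:C - 'i * v%:C) = u ^+ 2 + v ^+ 2.
  by rewrite /n2 /=; ring.
have -> : n2 (u%:C + 'i * v%:C) = u ^+ 2 + v ^+ 2.
  by rewrite /n2 /=; ring.
move=> /(mulIf uv0) /(pexpIrn m0).
have n0 z : n2 z \in Num.nneg by rewrite nnegrE addr_ge0 // sqr_ge0.
move=> /(_ (n0 _) (n0 _)); rewrite /n2; case: x x0 {P Q e ep em} => a b /= b0 h.
by case/negP: b0; apply/eqP; move: h; rewrite ?addr0 ?subr0 ?oppr0 ?addr0; lra.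
Qed.

End NonReal.

(** * Integrals over the real line through an antiderivative *)

Section RealLine.
Variable R : realType.
Implicit Types (f g F G : R -> R) (x y : R).
Let mu := @lebesgue_measure R.

(** Split at 0 and reflect the negative half-line. *)
Lemma ge0_line_integral f F (u v : R) :
  (forall x, 0 <= f x) -> continuous f -> (forall x, is_derive x 1 F (f x)) ->
  F x @[x --> +oo] --> v -> F (- x) @[x --> +oo] --> u ->
  (\int[mu]_x (f x)%:E = (v - u)%:E)%E.
Proof.
move=> f0 cf dF Fv Fu.
have half g G l : (forall x, 0 <= g x) -> continuous g ->
    (forall x, is_derive x 1 G (g x)) -> G x @[x --> +oo] --> l ->
    (\int[mu]_(x in `[0%R, +oo[) (g x)%:E = (l - G 0)%:E)%E.
  move=> g0 cg dG Gl; rewrite (@ge0_continuous_FTC2y _ _ G 0 l) //.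
  - apply/continuous_within_itvcyP; split; first by move=> x _; exact: cg.
    by apply: cvg_at_right_filter; exact: cg.
  - by apply: cvg_at_right_filter; apply: differentiable_continuous;
    exact/derivable1_diffP.
  - by move=> x _; rewrite derive1E; have := dG x => dGx; exact: derive_val.
have mf : measurable_fun [set: R] f by exact: continuous_measurable_fun.
rewrite -(setUv (`[0%R, +oo[ : set R)) ge0_integral_setU//=; last 4 first.
  exact: measurableC.
  by apply/measurable_EFinP; rewrite setUv.
  by move=> x _; rewrite lee_fin.
  exact/disj_setPCl.
rewrite setCitvr integral_itv_bndo_bndc;
  last exact/measurable_EFinP/measurable_funTS.
rewrite -{2}oppr0 ge0_integration_by_substitutionNy//;
  last exact: continuous_subspaceT.
have dFN x : is_derive x 1 (fun x => - F (- x)) ((f \o -%R) x).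
  rewrite (_ : (fun x => - F (- x)) = - (F \o -%R)) //.
  by apply: is_derive_eq; rewrite /= mulrN1 opprK.
have cfN : continuous (f \o -%R).
  by move=> x; apply: continuous_comp; [exact: opp_continuous|exact: cf].
have FNu : - F (- x) @[x --> +oo] --> - u by exact: cvgN.
rewrite (half f F v f0 cf dF Fv) (half _ _ _ (fun x => f0 (- x)) cfN dFN FNu).
rewrite oppr0 -EFinD; congr EFin; ring.
Qed.

Lemma ge0_line_integrable f (l : R) : (forall x, 0 <= f x) -> continuous f ->
  (\int[mu]_x (f x)%:E = l%:E)%E -> integrable_line f.
Proof.
move=> f0 cf fl; apply/integrableP; split.
  by apply/measurable_EFinP; exact: continuous_measurable_fun.
under eq_integral => x _ do rewrite /= ger0_norm ?f0 //.
by rewrite fl ltry.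
Qed.

(** Adding K/(1 + x^2), whose primitive is K atan, reduces to a nonnegative
    integrand. *)
Lemma line_integral_bounded f F (K u v : R) : continuous f ->
  (forall x, `|f x| <= K / (1 + x ^+ 2)) -> (forall x, is_derive x 1 F (f x)) ->
  F x @[x --> +oo] --> v -> F (- x) @[x --> +oo] --> u ->
  integrable_line f /\ integral_line f = v - u.
Proof.
move=> cf fK dF Fv Fu.
pose w x := K / (1 + x ^+ 2).
have cw : continuous w.
  by move=> x; apply: cvgM; [exact: cvg_cst|exact: continuous_oneDsqrV].
have w0 x : 0 <= w x by exact: le_trans (normr_ge0 _) (fK x).
have dW x : is_derive x 1 (K \*: (@atan R)) (w x).
  exact: (@is_deriveZ _ _ _ _ K x 1 _ (is_derive1_atan x)).
have cNatan : (@atan R) (- x) @[x --> +oo] --> - (pi / 2).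
  by under eq_fun do rewrite atanN; apply: cvgN; exact: cvgy_atan.
have Wl : (\int[mu]_x (w x)%:E = (K * (pi / 2) - K * - (pi / 2))%:E)%E.
  apply: (ge0_line_integral w (K \*: (@atan R))) => //.
    by apply: cvgM; [exact: cvg_cst|exact: cvgy_atan].
  by apply: cvgM; [exact: cvg_cst|exact: cNatan].
(* f + w is nonnegative and has the primitive F + K atan. *)
have fw0 x : 0 <= f x + w x.
  by have := fK x; rewrite ler_norml -/(w x) => /andP[]; lra.
have cfw : continuous (f \+ w) by move=> x; apply: cvgD; [exact: cf|exact: cw].
have FWl : (\int[mu]_x (f x + w x)%:E
            = (v + K * (pi / 2) - (u + K * - (pi / 2)))%:E)%E.
  apply: (ge0_line_integral (f \+ w) (F + K \*: (@atan R))) => //.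
    by apply: cvgD => //; apply: cvgM; [exact: cvg_cst|exact: cvgy_atan].
  by apply: cvgD => //; apply: cvgM; [exact: cvg_cst|exact: cNatan].
have iw := ge0_line_integrable w _ w0 cw Wl.
have ifw := ge0_line_integrable (f \+ w) _ fw0 cfw FWl.
have -> : f = (fun x => (f \+ w) x - w x) by apply/funext => x;
  rewrite /= addrK.
split; first exact: (integrableB measurableT ifw iw).
rewrite /integral_line RintegralB // /Rintegral /= FWl Wl /=; ring.
Qed.
(** The substitution x = cot t, with the primitive - G(pi/2 - atan x). The bound on
    the integrand comes from compactness of [0, pi]. *)
Lemma line_integral_cot f g G : continuous g -> (forall t : R, is_derive t 1 G
  (g t)) ->
  (forall x, f x = g (pi / 2 - atan x) / (1 + x ^+ 2)) ->
  integrable_line f /\ integral_line f = G pi - G 0.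
Proof.
move=> cg dG fE.
pose th x : R := pi / 2 - atan x.
have cth : continuous th.
  by move=> x; apply: cvgB; [exact: cvg_cst|exact: continuous_atan].
have cG : continuous G.
  by move=> x; apply: differentiable_continuous; exact/derivable1_diffP.
have dth x : is_derive x 1 (th : R -> R) (- (1 + x ^+ 2)^-1).
  exact: is_derive_eq (is_deriveB (is_derive_cst (pi / 2 : R) x 1)
    (is_derive1_atan x)) (sub0r _).
have pi20 : 0 <= pi :> R := pi_ge0 R.
have [K gK] : exists K, forall x, `|g (th x)| <= K.
  have cgn : {within `[0, pi], continuous (fun t => `|g t|)}.
    apply: continuous_subspaceT => t.
    by apply: continuous_comp; [exact: cg|exact: norm_continuous].
  have [c _ gc] := EVT_max pi20 cgn.
  exists `|g c| => x; apply: gc; rewrite in_itv /= /th.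
  have := atan_gtNpi2 x; have := atan_ltpi2 x; lra.
have cf : continuous f.
  have -> : f = (fun x => (g \o th) x * (1 + x ^+ 2)^-1) by apply/funext.
  move=> x; apply: cvgM; last exact: continuous_oneDsqrV.
  by apply: continuous_comp; [exact: cth|exact: cg].
have pos x : 0 < 1 + x ^+ 2 by rewrite ltr_pwDl // sqr_ge0.
have [] := @line_integral_bounded f (- (G \o th)) K (- G pi) (- G 0) cf.
- move=> x; rewrite fE normrM normfV (gtr0_norm (pos x)).
  by rewrite ler_pM2r ?invr_gt0 // gK.
- move=> x; apply: is_derive_eq (is_deriveN _) _; rewrite fE -/(th x); ring.
- apply: cvgN; apply: continuous_cvg; first exact: cG.
  rewrite -(subrr (pi / 2)); apply: cvgB; [exact: cvg_cst|exact: cvgy_atan].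
- apply: cvgN; apply: continuous_cvg; first exact: cG.
  have -> : pi = pi / 2 - (- (pi / 2)) :> R by field.
  apply: cvgB; first exact: cvg_cst.
  by under eq_fun do rewrite atanN; apply: cvgN; exact: cvgy_atan.
- by move=> fi fl; split => //; rewrite fl; ring.
Qed.
(** Fundamental theorem of calculus on a bounded interval around each point; the
    oriented integral from 0 does not depend on the interval. *)
Lemma continuous_antiderivative g : continuous g ->
  exists G, forall t : R, is_derive t 1 G (g t).
Proof.
move=> cg.
pose G x := \int[mu]_(t in [set` Interval (BRight 0) (BRight x)]) g t
          - \int[mu]_(t in [set` Interval (BRight x) (BRight 0)]) g t.
exists G => t.
pose a : R := - (`|t| + 1); pose b : R := `|t| + 1.
have a0 : a < 0 by rewrite oppr_lt0 ltr_pwDr.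
have b0 : 0 < b by rewrite ltr_pwDr.
have at_ : a < t by rewrite /a ltrNl (le_lt_trans (ler_norm _)) // normrN ltrDl.
have tb : t < b by rewrite /b (le_lt_trans (ler_norm _)) // ltrDl.
pose I x := \int[mu]_(u in [set` Interval (BRight a) (BRight x)]) g u.
have ig : mu.-integrable [set` Interval (BRight a) (BRight b)] (EFin \o g).
  apply: (@integrableS _ _ _ mu `[a, b]) => //.
    by apply: subset_itvr; rewrite bnd_simp.
  apply: continuous_compact_integrable; first exact: segment_compact.
  exact: continuous_subspaceT.
have [dI I'E] : derivable I t 1 /\ derive1 I t = g t.
  by apply: (@continuous_FTC1 _ g (BRight a) t b tb ig) (cg t).
have igs x : x <= b -> mu.-integrable [set` Interval (BRight a) (BRight x)]
  (EFin \o g).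
  move=> xb; apply: integrableS ig => //.
  by apply: subset_itvl; rewrite bnd_simp.
have GE x : a < x < b -> G x = I x - I 0.
  case/andP => ax xb; rewrite /G /I; have [x0|x0] := leP 0 x.
    have := @Rintegral_itvB _ g (BRight a) (BRight x) 0 (igs _ (ltW xb)).
    rewrite !bnd_simp (ltW a0) x0 => /(_ isT isT) ->.
    rewrite [X in _ - X](_ : _ = 0) ?subr0 //.
    by rewrite set_itv_ge ?Rintegral_set0 // bnd_simp -leNgt.
  have := @Rintegral_itvB _ g (BRight a) (BRight 0) x (igs _ (ltW b0)).
  rewrite !bnd_simp (ltW ax) (ltW x0) => /(_ isT isT) <-.
  rewrite [X in X - _](_ : _ = 0) ?sub0r ?opprB //.
  by rewrite set_itv_ge ?Rintegral_set0 // bnd_simp -leNgt ltW.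
have dI0 : is_derive t 1 (I - cst (I 0)) (g t).
  have dIt : is_derive t 1 I (g t) by rewrite -I'E derive1E; exact/derivableP.
  by apply: is_derive_eq; rewrite subr0.
apply: near_eq_is_derive dI0.
near=> x; rewrite GE //; near: x.
have : t \in `]a, b[ by rewrite in_itv /= at_ tb.
move/near_in_itvoo; apply: filterS => x; by rewrite in_itv.
Unshelve. all: by end_near.
Qed.

End RealLine.

(** * Integrals of complex functions over a period *)

Section PeriodIntegral.
Variable R : realType.
Implicit Types (g G : R -> R[i]) (t : R) (v w z : R[i]).

(** Continuity is stated on components because derivatives and integrals are only
    taken of real functions. *)
Definition ccontinuous g : Prop :=
  continuous (@complex.Re R \o g) /\ continuous (@complex.Im R \o g).

Lemma ccontinuous_cst v : ccontinuous (fun=> v).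
Proof. by split=> t; exact: cvg_cst. Qed.

Lemma ccontinuousD g G : ccontinuous g -> ccontinuous G ->
  ccontinuous (fun t => g t + G t).
Proof.
move=> [cg1 cg2] [cG1 cG2]; split => t.
  rewrite (_ : _ \o _ = (@complex.Re R \o g) \+ (@complex.Re R \o G)).
    by apply: cvgD; [exact: cg1|exact: cG1].
  by apply/funext => u /=; rewrite Re_addc.
rewrite (_ : _ \o _ = (@complex.Im R \o g) \+ (@complex.Im R \o G)).
  by apply: cvgD; [exact: cg2|exact: cG2].
by apply/funext => u /=; rewrite Im_addc.
Qed.

Lemma ccontinuousM g G : ccontinuous g -> ccontinuous G ->
  ccontinuous (fun t => g t * G t).
Proof.
move=> [cg1 cg2] [cG1 cG2]; split => t.
  rewrite (_ : _ \o _ = fun u => complex.Re (g u) * complex.Re (G u)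
                               - complex.Im (g u) * complex.Im (G u)).
    by apply: cvgB; apply: cvgM; [exact: cg1|exact: cG1|exact: cg2|exact: cG2].
  by apply/funext => u /=; rewrite Re_mulc.
rewrite (_ : _ \o _ = fun u => complex.Re (g u) * complex.Im (G u)
                             + complex.Im (g u) * complex.Re (G u)).
  by apply: cvgD; apply: cvgM; [exact: cg1|exact: cG2|exact: cg2|exact: cG1].
by apply/funext => u /=; rewrite Im_mulc.
Qed.

Lemma ccontinuousX g n : ccontinuous g -> ccontinuous (fun t => g t ^+ n).
Proof.
move=> cg; elim: n => [|n IH]; first exact: ccontinuous_cst.
under eq_fun do rewrite exprS; exact: ccontinuousM.
Qed.

Lemma ccontinuous_prod (I : Type) (s : seq I) (F : I -> R -> R[i]) :
  (forall i, ccontinuous (F i)) -> ccontinuous (fun t => \prod_(i <- s) F i t).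
Proof.
move=> cF; elim: s => [|i s IH].
  by under eq_fun do rewrite big_nil; exact: ccontinuous_cst.
by under eq_fun do rewrite big_cons; exact: ccontinuousM.
Qed.

Lemma ccontinuous_sum (I : Type) (s : seq I) (F : I -> R -> R[i]) :
  (forall i, ccontinuous (F i)) -> ccontinuous (fun t => \sum_(i <- s) F i t).
Proof.
move=> cF; elim: s => [|i s IH].
  by under eq_fun do rewrite big_nil; exact: ccontinuous_cst.
by under eq_fun do rewrite big_cons; exact: ccontinuousD.
Qed.

Lemma ccontinuousV g : (forall t, g t != 0) -> ccontinuous g ->
  ccontinuous (fun t => (g t)^-1).
Proof.
move=> g0 [cg1 cg2].
have n0 t : complex.Re (g t) ^+ 2 + complex.Im (g t) ^+ 2 != 0.
  apply: contra (g0 t); rewrite paddr_eq0 ?sqr_ge0 // !sqrf_eq0.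
  by case: (g t) => a b /= /andP[/eqP -> /eqP ->].
have cn t : (fun u => (complex.Re (g u) ^+ 2 + complex.Im (g u) ^+ 2)^-1) u
    @[u --> t] --> (complex.Re (g t) ^+ 2 + complex.Im (g t) ^+ 2)^-1.
  apply: cvgV; first exact: n0.
  by apply: cvgD; rewrite expr2; apply: cvgM; first [exact: cg1|exact: cg2].
split => t.
  rewrite (_ : _ \o _ = fun u => complex.Re (g u) *
      (complex.Re (g u) ^+ 2 + complex.Im (g u) ^+ 2)^-1).
    by apply: cvgM; [exact: cg1|exact: cn].
  by apply/funext => u /=; rewrite Re_invc.
rewrite (_ : _ \o _ = fun u => - complex.Im (g u) *
    (complex.Re (g u) ^+ 2 + complex.Im (g u) ^+ 2)^-1).
  by apply: cvgM; [apply: cvgN; exact: cg2|exact: cn].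
by apply/funext => u /=; rewrite Im_invc.
Qed.

Lemma ccontinuous_scale g (k : R) : ccontinuous g ->
  ccontinuous (fun t => g (k * t)).
Proof.
have ck : continuous (fun t : R => k * t).
  by move=> t; apply: cvgM; [exact: cvg_cst|exact: cvg_id].
move=> [cg1 cg2]; split=> t.
  by apply: (@continuous_comp _ _ _ (fun t => k * t) (@complex.Re R \o g));
    [exact: ck|exact: cg1].
by apply: (@continuous_comp _ _ _ (fun t => k * t) (@complex.Im R \o g));
  [exact: ck|exact: cg2].
Qed.

Definition cis t : R[i] := cos t +i* sin t.

Lemma cisD t u : cis (t + u) = cis t * cis u.
Proof.
by apply: complex_eqP; rewrite ?Re_mulc ?Im_mulc /= (cosD, sinD) // addrC.
Qed.

Lemma cis0 : cis 0 = 1. Proof. by rewrite /cis cos0 sin0. Qed.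

Lemma cisM (n : nat) t : cis (n%:R * t) = cis t ^+ n.
Proof.
elim: n => [|n IH]; first by rewrite mul0r cis0.
by rewrite -natr1 mulrDl mul1r cisD IH exprSr.
Qed.

Lemma cispi : cis pi = -1.
Proof. by rewrite /cis cospi sinpi; apply: complex_eqP; rewrite /= ?oppr0. Qed.

Lemma cis_neq0 t : cis t != 0.
Proof.
rewrite eq_complex /= -(sqrf_eq0 (cos t)) -(sqrf_eq0 (sin t)).
by apply/negP => /andP[/eqP a /eqP b]; have := cos2Dsin2 t; rewrite a b; lra.
Qed.

Lemma ccontinuous_cis : ccontinuous cis.
Proof. by split=> t; [exact: continuous_cos|exact: continuous_sin]. Qed.

Definition antiderivative G g : Prop :=
  (forall t, is_derive t (1 : R) (@complex.Re R \o G) (complex.Re (g t))) /\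
  (forall t, is_derive t (1 : R) (@complex.Im R \o G) (complex.Im (g t))).

Lemma antiderivativeD G1 G2 g1 g2 : antiderivative G1 g1 ->
  antiderivative G2 g2 ->
  antiderivative (fun t => G1 t + G2 t) (fun t => g1 t + g2 t).
Proof.
move=> [a1 b1] [a2 b2]; split => t.
  rewrite (_ : _ \o _ = (@complex.Re R \o G1) + (@complex.Re R \o G2)).
    by rewrite Re_addc; exact: is_deriveD.
  by apply/funext => u /=; rewrite Re_addc.
rewrite (_ : _ \o _ = (@complex.Im R \o G1) + (@complex.Im R \o G2)).
  by rewrite Im_addc; exact: is_deriveD.
by apply/funext => u /=; rewrite Im_addc.
Qed.

Lemma antiderivativeZ z G g : antiderivative G g ->
  antiderivative (fun t => z * G t) (fun t => z * g t).
Proof.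
move=> [a b]; split => t.
  rewrite (_ : _ \o _ = complex.Re z \*: (@complex.Re R \o G)
                      - complex.Im z \*: (@complex.Im R \o G)).
    by rewrite Re_mulc; apply: is_deriveB.
  by apply/funext => u /=; rewrite Re_mulc.
rewrite (_ : _ \o _ = complex.Re z \*: (@complex.Im R \o G)
                    + complex.Im z \*: (@complex.Re R \o G)).
  by rewrite Im_mulc; apply: is_deriveD.
by apply/funext => u /=; rewrite Im_mulc.
Qed.

(** The value is k^-1 * (k * g(kt + u)), which is g(kt + u) when k is nonzero; this
    form needs no case distinction. *)
Lemma antiderivative_affine (k u : R) G g : antiderivative G g ->
  antiderivative (fun t => k^-1%:C * G (k * t + u)) (fun t => k^-1%:C * (k%:C *
    g (k * t + u))).
Proof.
move=> [a b]; apply: antiderivativeZ.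
have da t : is_derive t (1 : R) (fun t => k * t + u : R) k.
  apply: (is_derive_eq (is_deriveD (@is_deriveZ _ _ _ id k t 1 _ (is_derive_id
    _ _))
     (is_derive_cst u t 1))).
  by rewrite addr0 /GRing.scale /= mulr1.
split=> t; rewrite ?Re_mulc ?Im_mulc /= mul0r ?subr0 ?addr0 mulrC.
  exact: (@is_derive1_comp _ (@complex.Re R \o G) (fun t => k * t + u)).
exact: (@is_derive1_comp _ (@complex.Im R \o G) (fun t => k * t + u)).
Qed.

(** The integral of g over one period of length pi, encoded by the increment of a
    primitive. No measure theory is involved, so shift and dilation are immediate. *)
Definition period_integral g v : Prop :=
  exists2 G, antiderivative G g & forall t, G (t + pi) - G t = v.

Lemma period_integral0 : period_integral (fun=> 0) 0.
Proof.
exists (fun=> 0) => [|t]; last by rewrite subr0.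
by split=> t; exact: is_derive_cst.
Qed.

Lemma period_integralD g1 g2 v1 v2 : period_integral g1 v1 ->
  period_integral g2 v2 -> period_integral (fun t => g1 t + g2 t) (v1 + v2).
Proof.
move=> [G1 d1 e1] [G2 d2 e2]; exists (fun t => G1 t + G2 t).
  exact: antiderivativeD.
by move=> t; rewrite -(e1 t) -(e2 t); ring.
Qed.

Lemma period_integralZ z g v : period_integral g v ->
  period_integral (fun t => z * g t) (z * v).
Proof.
move=> [G d e]; exists (fun t => z * G t); first exact: antiderivativeZ.
by move=> t; rewrite -mulrBr e.
Qed.

Lemma period_integral_sum (I : Type) (s : seq I) (F : I -> R -> R[i]) (v : I ->
  R[i]) :
  (forall i, period_integral (F i) (v i)) ->
  period_integral (fun t => \sum_(i <- s) F i t) (\sum_(i <- s) v i).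
Proof.
move=> Fv; elim: s => [|i s IH].
  by under eq_fun do rewrite big_nil; rewrite big_nil; exact: period_integral0.
under eq_fun do rewrite big_cons; rewrite big_cons; exact: period_integralD.
Qed.

(** The primitive G(nt)/n increases over pi by 1/n times the increment of G over
    n periods. *)
Lemma period_integral_dilation g v (n : nat) : (0 < n)%N ->
  period_integral g v -> period_integral (fun t => g (n%:R * t)) v.
Proof.
move=> n0 [G d e].
have nn : n%:R != 0 :> R by rewrite pnatr_eq0 -lt0n.
exists (fun t => (n%:R)^-1%:C * G (n%:R * t + 0)).
  have := antiderivative_affine n%:R 0 G g d; congr antiderivative.
  apply/funext => t; rewrite addr0 mulrA -rmorphM /= mulVf // mul1r //.
move=> t; rewrite !addr0 mulrDr -mulrBr.
suff -> : G (n%:R * t + n%:R * pi) - G (n%:R * t) = n%:R * v.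
  have nC : (n%:R^-1 : R)%:C * n%:R = 1 :> R[i].
    by rewrite -(rmorph_nat (real_complex R) n) -rmorphM /= mulVf.
  by rewrite mulrA nC mul1r.
elim: n {n0 nn} (n%:R * t) => [|n IH] u; first by rewrite !mul0r addr0 subrr.
by rewrite -!natr1 !mulrDl !mul1r -(IH u) -(e (u + n%:R * pi)) addrA; ring.
Qed.

(** The increment of a primitive over a period of g has derivative 0. *)
Lemma period_integral_exists g : ccontinuous g -> (forall t, g (t + pi) = g t)
  ->
  exists v, period_integral g v.
Proof.
move=> [c1 c2] gp.
have [G1 d1] := continuous_antiderivative _ _ c1.
have [G2 d2] := continuous_antiderivative _ _ c2.
have cst (h : R -> R) (H : R -> R) : (forall t : R, is_derive t 1 H (h t)) ->
    (forall t, h (t + pi) = h t) -> forall t, H (t + pi) - H t = H pi - H 0.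
  move=> dH hp t; rewrite -[in RHS](add0r pi).
  apply: (@is_derive_0_is_cst _ (fun t => H (t + pi) - H t)) => u.
  have da : is_derive u (1 : R) (fun t => t + pi : R) 1.
    apply: (is_derive_eq (is_deriveD (is_derive_id u 1) (is_derive_cst pi u
      1))).
    by rewrite addr0.
  have dc : is_derive u 1 (H \o (fun t => t + pi : R)) (h (u + pi) * 1).
    exact: is_derive1_comp.
  apply: (is_derive_eq (is_deriveB dc (dH u))).
  by rewrite hp mulr1 subrr.
exists ((G1 pi - G1 0) +i* (G2 pi - G2 0)), (fun t => G1 t +i* G2 t) => //.
move=> t; apply: complex_eqP; rewrite /=.
  by apply: cst d1 _ t => u /=; rewrite gp.
by apply: cst d2 _ t => u /=; rewrite gp.
Qed.

(** If G is a primitive of g, so is (G(t + u) - G(t))/(z - 1); the increment over a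
    period is the same for the two terms and cancels. *)
Lemma period_integral_shift g (u : R) z : ccontinuous g ->
  (forall t, g (t + pi) = g t) -> (forall t, g (t + u) = z * g t) -> z != 1 ->
  period_integral g 0.
Proof.
move=> cg gp gu z1; have [v [G d e]] := period_integral_exists g cg gp.
have z10 : z - 1 != 0 by rewrite subr_eq0.
exists (fun t => (z - 1)^-1 * (G (t + u) + -1 * G t)); last first.
  move=> t; rewrite (addrAC t pi u).
  have -> : G (t + u + pi) = G (t + u) + v by rewrite -(e (t + u)); ring.
  have -> : G (t + pi) = G t + v by rewrite -(e t); ring.
  by ring.
have -> : g = (fun t => (z - 1)^-1 * (g (t + u) + -1 * g t)).
  by apply/funext => t; rewrite gu; field.
apply/antiderivativeZ/antiderivativeD; last exact: antiderivativeZ.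
have := antiderivative_affine 1 u G g d.
by congr antiderivative; apply/funext => t; rewrite invr1 !mul1r.
Qed.

Lemma cis_pi_neq1 (m k : nat) : (0 < k < m)%N -> cis (pi / m%:R) ^+ (2 * k) !=
  1.
Proof.
case/andP => k0 km; rewrite mulnC exprM -cisM sqrf_eq1.
have m0 : 0 < m%:R :> R by rewrite ltr0n (leq_ltn_trans _ km).
have s0 : 0 < sin (k%:R * (pi / m%:R) : R).
  apply: sin_gt0_pi; rewrite mulr_gt0 ?ltr0n ?divr_gt0 ?pi_gt0 //=.
  by rewrite mulrCA gtr_pMr ?pi_gt0 // ltr_pdivrMr // mul1r ltr_nat.
by apply/negP => /orP[] /eqP [_ s]; move: s0; rewrite s ?oppr0 ltxx.
Qed.

(** Averaging over the m-th roots of unity, one residue class of frequencies at a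
    time: only the frequencies divisible by m survive, and for them the angle mt
    can be replaced by t. *)
Lemma period_integral_decimation (psi : R -> R[i]) (a : nat -> R[i]) (m n :
  nat) :
  (0 < m)%N -> ccontinuous psi -> (forall t, psi (t + pi) = psi t) ->
  exists v,
    period_integral (fun t => \sum_(k < m * n) a k * (cis t ^+ (2 * k) * psi
      (m%:R * t))) v
    /\ period_integral (fun t => \sum_(j < n) a (m * j)%N * (cis t ^+ (2 * j) *
      psi t)) v.
Proof.
move=> m0 cpsi psip.
have cpi t : cis (t + pi) ^+ 2 = cis t ^+ 2 by rewrite cisD cispi mulrN1 sqrrN.
(* For l = m: the function t -> psi (m t) also has period pi. *)
have psi_nat l t : psi (t + l%:R * pi) = psi t.
  elim: l => [|l IH]; first by rewrite mul0r addr0.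
  by rewrite -natr1 mulrDl mul1r addrA psip.
elim: n => [|n [v [IH1 IH2]]].
  exists 0; rewrite muln0; split; under eq_fun do rewrite big_ord0;
    exact: period_integral0.
have [w hw] : exists w, period_integral (fun t => cis t ^+ (2 * n) * psi t) w.
  apply: period_integral_exists.
    by apply: ccontinuousM => //; apply: ccontinuousX; exact: ccontinuous_cis.
  by move=> t; rewrite psip !exprM cpi.
exists (v + a (m * n)%N * w); split; last first.
  under eq_fun do rewrite big_ord_recr /=.
  by apply: period_integralD => //; exact: period_integralZ.
rewrite (_ : (fun t => _) = (fun t =>
    (\sum_(k < m * n) a k * (cis t ^+ (2 * k) * psi (m%:R * t)))
  + \sum_(k < m) a (m * n + k)%N * (cis t ^+ (2 * (m * n + k)) * psi (m%:R *
    t)))); last first.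
  by apply/funext => t; rewrite mulnS addnC big_split_ord.
apply: period_integralD => //.
rewrite (_ : a (m * n)%N * w = \sum_(k < m) if val k == 0%N then a (m * n)%N *
  w else 0); last first.
  by case: m m0 {IH1 IH2} => // m _; rewrite big_ord_recl /= big1 ?addr0.
apply: period_integral_sum => k; case: eqP => [->|/eqP k0].
  rewrite addn0; apply: period_integralZ.
  have := period_integral_dilation _ _ m m0 hw; congr period_integral.
  by apply/funext => t /=; rewrite cisM -exprM mulnCA.
(* m does not divide the frequency: shift by pi / m. *)
rewrite -[0](mulr0 (a (m * n + k)%N)); apply: period_integralZ.
apply: (@period_integral_shift _ (pi / m%:R) (cis (pi / m%:R) ^+ (2 * k))).
- apply: ccontinuousM; first by apply: ccontinuousX; exact: ccontinuous_cis.
  exact: ccontinuous_scale.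
- move=> t; rewrite !exprM cpi mulrDr; congr (_ * _).
  exact: psi_nat.
- move=> t; have mR : m%:R != 0 :> R by rewrite pnatr_eq0 -lt0n.
  have -> : m%:R * (t + pi / m%:R) = m%:R * t + pi by field.
  rewrite psip cisD exprMn [in X in _ * X * _]mulnDr exprD.
  have -> : cis (pi / m%:R) ^+ (2 * (m * n)) = 1.
    have -> : cis (pi / m%:R) ^+ (2 * (m * n)) = (cis (pi / m%:R) ^+ m) ^+ 2 ^+
      n.
      by rewrite -!exprM mulnCA mulnA.
    by rewrite -cisM mulrCA mulfV // mulr1 cispi sqrrN !expr1n.
  by ring.
- by apply: cis_pi_neq1; rewrite lt0n k0 /=.
Qed.

Lemma line_integral_period f g v : ccontinuous g -> period_integral g v ->
  (forall x, f x = g (pi / 2 - atan x) / (1 + x ^+ 2)%:C) ->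
  cintegrable_line f /\ cintegral_line f = v.
Proof.
move=> [c1 c2] [G [d1 d2] e] fE.
pose q x : R := 1 + x ^+ 2.
have qC x : ((q x)%:C)^-1 = ((q x)^-1)%:C :> R[i] by rewrite fmorphV.
have fRe x : complex.Re (f x) = complex.Re (g (pi / 2 - atan x)) / q x.
  by rewrite fE qC Re_mulc /= mulr0 subr0.
have fIm x : complex.Im (f x) = complex.Im (g (pi / 2 - atan x)) / q x.
  by rewrite fE qC Im_mulc /= mulr0 add0r.
have [i1 e1] := line_integral_cot R (fun x => complex.Re (f x)) _ _ c1 d1 fRe.
have [i2 e2] := line_integral_cot R (fun x => complex.Im (f x)) _ _ c2 d2 fIm.
split; first by split.
rewrite /cintegral_line e1 e2 -(e 0) add0r /=.
by apply: complex_eqP; rewrite (Re_addc, Im_addc) /=; case: (G 0).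
Qed.

Lemma cis_conj t : cis t * (cos t -i* sin t) = 1.
Proof.
have := cos2Dsin2 t; rewrite /cis => h; apply: complex_eqP; rewrite /=.
  by rewrite mulrN opprK -!expr2.
by rewrite mulrN mulrC addNr.
Qed.

Lemma cisV t : (cis t)^-1 = cos t -i* sin t.
Proof.
by apply: (mulfI (cis_neq0 t)); rewrite mulfV ?cis_neq0 // cis_conj.
Qed.

Lemma cos_cis t : (cos t)%:C = (cis t + (cis t)^-1) / 2.
Proof.
rewrite cisV; have two : 2 != 0 :> R[i] by rewrite pnatr_eq0.
by apply: (mulIf two); rewrite mulfVK // mulr_natr mulr2n; apply: complex_eqP;
  rewrite /= ?subrr ?addr0.
Qed.

Lemma sin_cis t : (sin t)%:C = (cis t - (cis t)^-1) / (2 * 'i).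
Proof.
rewrite cisV; have two : 2 * 'i != 0 :> R[i].
  by rewrite mulf_neq0 ?pnatr_eq0 // eq_complex /= oner_eq0 andbF.
apply: (mulIf two); rewrite mulfVK // mulrA mulr_natr mulr2n.
by apply: complex_eqP; rewrite /= ?subrr; ring.
Qed.

End PeriodIntegral.

(** * The rational Landen transformation *)

Theorem theorem6p3 (R : realType) (p m : nat)
    (p_gt0 : (0 < p)%N) (m_gt0 : (0 < m)%N) (p_even : ~~ odd p) (m_odd : odd m)
    (A B : {poly R})
    (size_A : size A = p.+1) (size_B : (size B <= p - 1)%N)
    (A_no_real_zero : forall x : R, ~~ root A x)
    (xs : seq R[i])
    (roots_A : map_poly (real_complex R) A
               = (lead_coef A)%:C *: \prod_(x <- xs) ('X - x%:P)) :
  let AC := map_poly (real_complex R) A in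
  let BC := map_poly (real_complex R) B in
  let z := dcoef (p * (m - 1)) (Zpoly AC m p xs) in
  let b := dcoef (p - 2) BC in
  let c := ccoef z b in
  let H := Hpoly (lead_coef AC) m p xs in
  let J := Jpoly m p c in
  [/\ integrable_line (fun x : R => B.[x] / A.[x]),
      cintegrable_line (fun x : R => J.[x%:C] / H.[x%:C]) &
      (integral_line (fun x : R => B.[x] / A.[x]))%:C
      = cintegral_line (fun x : R => J.[x%:C] / H.[x%:C])].
Proof.
move=> AC BC z b c H J.
have [nu pE] : exists nu, p = (2 * nu.+1)%N.
  exists (p./2.-1); have := odd_double_half p; rewrite (negbTE p_even) -mul2n;
    lia.
have i2 : 'i * 'i = -1 :> R[i] by rewrite -expr2 sqr_i.
have A0 : A != 0 by rewrite -size_poly_gt0 size_A.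
have AC0 : AC != 0 by rewrite map_poly_eq0.
pose a0 := lead_coef AC.
have lA : (lead_coef A)%:C = a0 by rewrite /a0 lead_coef_map.
have a00 : a0 != 0 by rewrite lead_coef_eq0.
have ACE : AC = a0 *: \prod_(x <- xs) ('X - x%:P) by rewrite -lA.
have sAC : size AC = p.+1 by rewrite size_map_poly.
have sxs : size xs = p.
  by move: sAC; rewrite ACE size_scale // size_prod_XsubC => -[].
have xs_nonreal x : x \in xs -> complex.Im x != 0.
  move=> xxs; apply/negP => /eqP x0; case/negP: (A_no_real_zero (complex.Re x)).
  have xr : x = (complex.Re x)%:C by case: x x0 {xxs} => u v /= ->.
  have : root AC x by rewrite ACE rootZ // root_prod_XsubC.
  by rewrite xr /root horner_map /= fmorph_eq0.
pose PP := Ppoly R[i] m; pose QQ := Qpoly R[i] m.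
have Q0 : all (fun x => QQ.[x] != 0) xs.
  apply/allP => x /xs_nonreal x0.
  have := cot_factor_neq0 R x m 1 0 m_gt0 x0; rewrite mulr0 subr0 mulr1; apply.
  by rewrite expr1n expr0n addr0 oner_eq0.
(* The denominator on the circle: h(t) = H(cot t) sin^p t. *)
pose h (t : R) := a0 ^+ m * \prod_(x <- xs) (QQ.[x] * (cos t)%:C - PP.[x] *
  (sin t)%:C).
have h0 t : h t != 0.
  rewrite mulf_neq0 ?expf_neq0 // prodf_seq_neq0;
    apply/allP => x /xs_nonreal x0.
  by apply/implyP => _; apply: cot_factor_neq0; rewrite // cos2Dsin2 oner_eq0.
(* Each of the p factors changes sign under t -> t + pi, and p is even. *)
have hp t : h (t + pi) = h t.
  rewrite /h; congr (_ * _).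
  transitivity (\prod_(x <- xs) ((QQ.[x] * (cos t)%:C - PP.[x] * (sin t)%:C) *
    -1)).
    by apply: eq_bigr => x _; rewrite cosDpi sinDpi !rmorphN /=; ring.
  by rewrite prodr_scale sxs -signr_odd (negbTE p_even) expr0 mulr1.
pose psi t := (cis R t)^-1 ^+ p / h t.
have psip t : psi (t + pi) = psi t.
  rewrite /psi hp cisD cispi mulrN1 invrN pE !exprM sqrrN //.
have cC : ccontinuous R (fun t => (cos t)%:C).
  by split; [exact: continuous_cos|move=> t; exact: cvg_cst].
have cS : ccontinuous R (fun t => (sin t)%:C).
  by split; [exact: continuous_sin|move=> t; exact: cvg_cst].
have ch : ccontinuous R h.
  apply: ccontinuousM; first exact: ccontinuous_cst.
  apply: ccontinuous_prod => x; rewrite (_ : (fun t => _) =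
    (fun t => QQ.[x] * (cos t)%:C + (- PP.[x]) * (sin t)%:C)); last first.
    by apply/funext => t; rewrite mulNr.
  by apply: ccontinuousD; apply: ccontinuousM => //; exact: ccontinuous_cst.
have cpsi : ccontinuous R psi.
  apply: ccontinuousM; last exact: ccontinuousV.
  apply: ccontinuousX; apply: ccontinuousV; first exact: cis_neq0.
  exact: ccontinuous_cis.
pose s := (m * p - 2)%N.
have mp : (m * p = s.+2)%N.
  have : (1 * 2 <= m * p)%N by apply: leq_mul => //; rewrite pE; lia.
  rewrite /s; lia.
(* The term k = 0 is absent from the numerator; it is set to zero so that the
   range has mp elements. *)
pose a k := (2 ^+ s)^-1 * (if k is k'.+1 then tcoef R[i] 'i s c k' else 0).
have [v [hv1 hv2]] := period_integral_decimation R psi a m p m_gt0 cpsi psip.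
have cterm (f : R -> R[i]) (u : R[i]) n : ccontinuous R f ->
    ccontinuous R (fun t => u * (cis R t ^+ n * f t)).
  move=> cf; apply: ccontinuousM; first exact: ccontinuous_cst.
  by apply: ccontinuousM => //; apply: ccontinuousX; exact: ccontinuous_cis.
(* Transfer to the line: the factor sin^2 t is the Jacobian 1/(1 + x^2). *)
have cot (f : R -> R[i]) (g : R -> R[i]) : ccontinuous R g -> period_integral R
  g v ->
    (forall t, (sin t)%:C != 0 :> R[i] -> (sin t)%:C ^+ 2 * g t = f (cos t /
      sin t)) ->
    cintegrable_line f /\ cintegral_line f = v.
  move=> cg gv gf; apply: line_integral_period cg gv _ => x.
  set t := pi / 2 - atan x.
  have st : sin t = cos (atan x) by rewrite /t sinB sin_pihalf cos_pihalf; ring.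
  have ct : cos t = sin (atan x) by rewrite /t cosB sin_pihalf cos_pihalf; ring.
  have pos : 0 < 1 + x ^+ 2 by rewrite ltr_pwDl // sqr_ge0.
  have s0 : sin t != 0 by rewrite st cos_atan invr_eq0 gt_eqF // sqrtr_gt0.
  have xE : cos t / sin t = x by rewrite ct st -[LHS]/(tan (atan x)) atanK.
  have s2 : sin t ^+ 2 * (1 + x ^+ 2) = 1.
    have cx : cos t = x * sin t by rewrite -[in RHS]xE divfK.
    by transitivity (cos t ^+ 2 + sin t ^+ 2); [rewrite cx;
      ring|exact: cos2Dsin2].
  have s0C : (sin t)%:C != 0 :> R[i] by rewrite fmorph_eq0.
  rewrite -{1}xE -gf // mulrC; congr (_ * _).
  have q0 : (1 + x ^+ 2)%:C != 0 :> R[i] by rewrite fmorph_eq0 gt_eqF.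
  by apply: (mulIf q0); rewrite mulVf // -rmorphXn -rmorphM /= s2.
have szZ : (size (Zpoly AC m p xs) <= (p * (m - 1)).+1)%N.
  have := size_Epoly _ a0 m xs Q0; rewrite sxs => sE.
  have pm : (p <= m * p)%N by rewrite leq_pmull.
  rewrite /Zpoly size_divp // sAC /= mulnBr muln1 (mulnC p) -subSn //.
  exact: leq_sub2r.
have szB : (size BC <= (p - 2).+1)%N.
  by rewrite size_map_poly (leq_trans size_B) // pE; lia.
have ZA : Zpoly AC m p xs * AC = Epoly a0 m p xs.
  rewrite /Zpoly divpK // -[X in Epoly _ _ X]sxs; exact: dvd_Epoly.
have sE : (p * (m - 1) + (p - 2) = s)%N.
  by rewrite /s mulnBr muln1 (mulnC p); have : (p <= m * p)%N;
    [rewrite leq_pmull|rewrite pE; lia].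
pose ZB := Zpoly AC m p xs * BC.
have szZB : (size ZB <= s.+1)%N.
  rewrite -sE (leq_trans (size_polyMleq _ _)) //.
  have := leq_add szZ szB; rewrite addSn addnS.
  by case: (size _ + _)%N => [|k] /=; rewrite ?ltnS.
have cE j : (j <= s)%N -> c j = ZB`_(s - j).
  by move=> js; rewrite /c /z /b coef_conv // sE.
(* B/A is BZ/E, and E(cot t) sin^(mp) t = h(mt). *)
have [i1 e1] : cintegrable_line (fun x : R => (B.[x] / A.[x])%:C) /\
    cintegral_line (fun x : R => (B.[x] / A.[x])%:C) = v.
  apply: cot hv1 _.
    apply: ccontinuous_sum => k; apply: cterm; exact: ccontinuous_scale.
  move=> t s0; set e := cis R t; set S := (sin t)%:C in s0 *.
  have ee : e * e^-1 = 1 by rewrite mulfV // cis_neq0.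
  have xE : (cos t / sin t)%:C = (cos t)%:C / S by rewrite rmorphM fmorphV.
  rewrite rmorphM fmorphV /= -!horner_map /= xE -/AC -/BC.
  set C := (cos t)%:C; set ht := h (m%:R * t).
  have CE : C = (e + e^-1) / 2 by exact: cos_cis.
  have SE : S = (e - e^-1) / (2 * 'i) by exact: sin_cis.
  have psiE : psi (m%:R * t) = e^-1 ^+ (m * p) / ht.
    by rewrite /psi cisM -exprVn -exprM.
  have num : \sum_(k < m * p) a k * (e ^+ (2 * k) * psi (m%:R * t)) = ZB.[C /
    S] * S ^+ s / ht.
    rewrite horner_rev //; under [in RHS]eq_big_nat => j hj do rewrite -cE //.
    have := cot_numerator _ _ i2 (m * p) s c e e^-1 mp ee.
    rewrite -CE -SE => /(congr1 (fun u => (2 ^+ s)^-1 * u / ht)).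
    rewrite [X in _ = X / _]mulKf ?expf_neq0 ?pnatr_eq0 // => <-.
    rewrite big_mkord mulr_sumr mulr_suml; apply: eq_bigr => k _.
    by rewrite psiE /a -!mulrA.
  have htE : ht = (Zpoly AC m p xs).[C / S] * AC.[C / S] * (S ^+ s * S ^+ 2).
    rewrite -hornerM ZA -[X in Epoly _ _ X]sxs Epoly_horner // -exprD addn2 -mp.
    rewrite exprM -sxs -mulrA -prodr_scale /ht /h; congr (_ * _).
    apply: eq_bigr => x _; rewrite cos_cis sin_cis cisM -exprVn.
    have := Ppoly_Qpoly_cot _ _ i2 e e^-1 m m_gt0;
      rewrite -CE -SE => /(_ s0) [<- <-].
    by rewrite -/PP -/QQ; ring.
  have : ht != 0 by exact: h0.
  rewrite num htE hornerM !mulf_eq0 !negb_or -!andbA => /and4P[Z0 AC0' Ss _].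
  by field; rewrite Z0 AC0' Ss s0.
(* H(cot t) sin^p t = h(t), and J is the decimated numerator. *)
have [j1 j2] : cintegrable_line (fun x : R => J.[x%:C] / H.[x%:C]) /\
    cintegral_line (fun x : R => J.[x%:C] / H.[x%:C]) = v.
  apply: cot hv2 _.
    apply: ccontinuous_sum => k; exact: cterm.
  move=> t s0; set e := cis R t; set S := (sin t)%:C in s0 *.
  have ee : e * e^-1 = 1 by rewrite mulfV // cis_neq0.
  have xE : (cos t / sin t)%:C = (cos t)%:C / S by rewrite rmorphM fmorphV.
  rewrite xE; set C := (cos t)%:C.
  have CE : C = (e + e^-1) / 2 by exact: cos_cis.
  have SE : S = (e - e^-1) / (2 * 'i) by exact: sin_cis.
  have htE : h t = H.[C / S] * (S ^+ (2 * nu) * S ^+ 2).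
    rewrite /H -[X in Hpoly _ _ X]sxs Hpoly_horner // -exprD.
    rewrite (_ : (2 * nu + 2 = size xs)%N); last by rewrite sxs pE; lia.
    rewrite -mulrA -prodr_scale /h; congr (_ * _).
    by apply: eq_bigr => x _; rewrite mulrBl -mulrA divfK.
  have num : \sum_(j < p) a (m * j)%N * (e ^+ (2 * j) * psi t)
      = S ^+ (2 * nu) * J.[C / S] / h t.
    have := Jpoly_trig _ _ i2 m nu c e e^-1 m_gt0 ee; rewrite -CE -SE -pE.
    move=> /(_ s0); rewrite -/J -/s => ->.
    rewrite big_mkord mulr_sumr mulr_suml; apply: eq_bigr => k _.
    by rewrite /psi /a -!mulrA.
  have : h t != 0 by exact: h0.
  rewrite num htE !mulf_eq0 !negb_or => /and3P[H0 Sn _].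
  by field; rewrite H0 Sn s0.
split => //.
  by have := i1.1; congr integrable_line; apply/funext.
rewrite j2 -e1; apply: complex_eqP => //=.
by rewrite /integral_line /Rintegral integral0.
Qed.
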